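(* Let $\mathbf K$ be $\mathbf H$ or $\mathbf O$, let $n\in\mathbf N$, and let $U$ be a domain in $\mathbf K^n$ satisfying the standing domain condition (D). Let $\mathcal F$ be a family of $\mathbf K$-valued functions that are $\mathbf K$-holomorphic on $U$, such that each $f\in\mathcal F$, at each $\xi\in \mathrm{Int}(U)$ and by each variable ${}_jz$, $j=1,\dots,n$, is either pseudoconformal or satisfies $(\partial f(z)/\partial\,{}_jz)|_{z=\xi}=0$. Suppose in addition that $\mathcal F$ is uniformly bounded on $U$: $$\sup_{z\in \mathrm{Int}(U),\ f\in\mathcal F}|f(z)|=:c<\infty .$$ Then the family $\mathcal F$ is normal.
   Context: Notation. $\mathbf K$ is the quaternion skew field $\mathbf H$ ($r=2$) or the octonion algebra $\mathbf O$ ($r=3$), with standard generators $i_0=1,i_1,\dots,i_{2^r-1}$; $\tilde z=z^*$ is the conjugate, $|z|^2=z\tilde z$, $\mathrm{Re}(z)=(z+\tilde z)/2$. Functions of $z$ are represented by phrases (finite or convergent infinite sums of bracketed words in $z$, $\tilde z$ and constants of $\mathbf K$); $\partial f/\partial z$ and $\partial f/\partial\tilde z$ are the partial (super)derivatives, $\mathbf R$-linear operators $h\mapsto(\partial f/\partial z).h$ and $h\mapsto(\partial f/\partial\tilde z).h$ whose sum is the Fréchet derivative. $f$ is ($\mathbf K$-)holomorphic if it is differentiable with $\partial f/\partial\tilde z=0$ (by each variable); such $f$ is locally given by convergent power series $\sum_m\{a_{m,1}(z-z_0)^{m_1}\cdots a_{m,v}(z-z_0)^{m_v}\}$ with coefficients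 $a_{m,j}\in\mathbf K$ and prescribed brackets, and $f'(z)=\partial f/\partial z$. Pseudoconformal. A differentiable $f:U\to\mathbf K$, $U$ open in $\mathbf K$, is pseudoconformal at $\xi$ if (1) $\partial f(z)/\partial\tilde z=0$ at $z=\xi$; (2) $\mathrm{Re}\{[f'(\xi).h_1][f'(\xi).h_2]^*\}|h_1||h_2|=|f'(\xi).h_1||f'(\xi).h_2|\,\mathrm{Re}(h_1\tilde h_2)$ for all $h_1,h_2\in\mathbf K$; (3) $f'(\xi)\neq0$; where nonproper rotations of the underlying space $\mathbf R^{2^r}$ associated with $f'$ are excluded. Pseudoconformal by ${}_jz$ at a point means this holds for $f$ as a function of ${}_jz$, where $z=({}_1z,\dots,{}_nz)\in\mathbf K^n$. Domain condition (D). For a subset $W\subset\mathbf K$ and distinct generators $s,p$, let $\mathbf C_{s,p}=\{as+bp:a,b\in\mathbf R\}$, let $\mathbf K_{r,s,p}$ be the set of $z\in\mathbf K$ whose coordinates along $s$ and $p$ vanish, and for $t\in\mathbf K_{r,s,p}$ let $\pi_{s,p,t}(W)=\{u\in\mathbf C_{s,p}:u+t\in W\}$. Condition (D) on $U\subset\mathbf K^n$: each coordinate projection $U_j=\{{}_jz:z\in U\}$ is $(2^r-1)$-connected (arcwise connected with trivial homotopy groups $\pi_k$ for $1\le k\le 2^r-1$), and $\pi_{s,p,t}(U_j)$ is simply connected in $\mathbf C$ for each $k=0,1,\dots,2^{r-1}-1$, $s=i_{2k}$, $p=i_{2k+1}$, $t\in\mathbf K_{r,s,p}$ and $u\in\mathbf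 C_{s,p}$ for which there exists $z=u+t\in U_j$. Normal family. For $V=\mathrm{cl}(\mathrm{Int}(V))$ closed bounded let $\rho_V(f,g)=\max_{z\in V}\big[|f(z)-g(z)|+\max_{|h|=1}|f'(z).h-g'(z).h|\big]$. A family $\mathcal F$ on $U$ is normal if each $f\in\mathcal F$ is holomorphic, at each $\xi\in U$ by each ${}_jz$ either pseudoconformal or with $\partial f/\partial\,{}_jz=0$, and for each infinite sequence in $\mathcal F$ and each closed bounded $V=\mathrm{cl}(\mathrm{Int}(V))\subset U$ there is a subsequence converging uniformly relative to $\rho_V$ to some limit function, which may also be a finite or infinite constant. *)

(* Defs.v *)
From HB Require Import structures.
From mathcomp Require Import all_boot all_order all_algebra.
From mathcomp Require Import all_classical all_reals all_analysis.

Set Implicit Arguments.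
Unset Strict Implicit.
Unset Printing Implicit Defensive.

Import Order.TTheory GRing.Theory Num.Theory.
Import numFieldNormedType.Exports.

Local Open Scope classical_set_scope.
Local Open Scope ring_scope.

(* The dimension 2 ^ r, defined by doubling so that an element of level r.+1
   splits definitionally into two elements of level r. *)
Fixpoint cd_dim (r : nat) : nat :=
  if r is s.+1 then (cd_dim s + cd_dim s)%N else 1%N.

Lemma cd_dimE r : cd_dim r = (2 ^ r)%N.
Proof. by elim: r => //= r ->; rewrite expnS mul2n addnn. Qed.

(* The real Cayley-Dickson algebra of level r in coordinates along the standard
   generators i_0, ..., i_(2^r - 1) (quaternions: r = 2, octonions: r = 3),
   and its n-th power, whose rows are the n variables.  An element of the
   algebra is thus also a point of the first power. *)
Notation cd R r := 'rV[R]_(cd_dim r) (only parsing).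
Notation cdn R r n := 'M[R]_(n, cd_dim r) (only parsing).

Section CayleyDickson.
Variable R : realType.

Fixpoint cd_conj (r : nat) : cd R r -> cd R r :=
  match r with
  | 0 => fun x => x
  | s.+1 => fun x : 'rV[R]_(cd_dim s + cd_dim s) =>
      row_mx (cd_conj (lsubmx x)) (- rsubmx x)
  end.

(* (a, b) (c, d) = (a c - d~ b, d a + b c~) *)
Fixpoint cd_mul (r : nat) : cd R r -> cd R r -> cd R r :=
  match r with
  | 0 => fun x y => \row_j (x ord0 j * y ord0 j)
  | s.+1 => fun x y : 'rV[R]_(cd_dim s + cd_dim s) =>
      let a := lsubmx x in let b := rsubmx x in
      let c := lsubmx y in let d := rsubmx y in
      row_mx (cd_mul a c - cd_mul (cd_conj d) b)
             (cd_mul d a + cd_mul b (cd_conj c))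
  end.

(* Re z, as a real number: the coordinate along i_0 *)
Fixpoint cd_re (r : nat) : cd R r -> R :=
  match r with
  | 0 => fun x => x ord0 ord0
  | s.+1 => fun x : 'rV[R]_(cd_dim s + cd_dim s) => cd_re (lsubmx x)
  end.

Fixpoint cd_one (r : nat) : cd R r :=
  match r with
  | 0 => const_mx 1
  | s.+1 => row_mx (cd_one s) 0
  end.

(* Euclidean norm; the library norm on matrices is the max norm, which is used
   below only for topological notions. *)
Definition enorm (m d : nat) (x : 'M[R]_(m, d)) : R :=
  Num.sqrt (\sum_i \sum_j x i j ^+ 2).

Lemma cd_conjK r : involutive (@cd_conj r).
Proof.
elim: r => //= r IHr x.
by rewrite row_mxKl row_mxKr IHr opprK hsubmxK.
Qed.

Lemma cd_re_conj r (x : cd R r) : x + cd_conj x = (2 * cd_re x) *: cd_one r.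
Proof.
elim: r x => [|r IHr] x /=.
  by apply/rowP => j; rewrite !mxE (ord1 j) mulr1 mulr_natl.
rewrite -{1}(hsubmxK (x : 'rV[R]_(cd_dim r + cd_dim r))).
by rewrite add_row_mx IHr subrr scale_row_mx scaler0.
Qed.

Lemma cd_conjN r (x : cd R r) : cd_conj (- x) = - cd_conj x.
Proof. by elim: r x => //= s IHs x; rewrite !linearN /= IHs opp_row_mx. Qed.

Lemma cd_mulN r (x y : cd R r) :
  cd_mul x (- y) = - cd_mul x y /\ cd_mul (- x) y = - cd_mul x y.
Proof.
elim: r x y => [|r IHr] x y /=.
  by split; apply/rowP => j; rewrite !mxE ?mulrN ?mulNr.
rewrite !linearN /= !cd_conjN !(IHr _ _).1 !(IHr _ _).2.
by split; rewrite opp_row_mx !opprD.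
Qed.

Lemma enorm_cdE r (x : cd R r) : enorm x ^+ 2 = \sum_j x ord0 j ^+ 2.
Proof.
rewrite /enorm sqr_sqrtr big_ord1 //.
by apply: sumr_ge0 => j _; rewrite sqr_ge0.
Qed.

Lemma enorm_conj r (x : cd R r) : enorm (cd_conj x) ^+ 2 = enorm x ^+ 2.
Proof.
rewrite !enorm_cdE; elim: r x => //= r IHr x.
rewrite [LHS]big_split_ord [RHS]big_split_ord /=; congr (_ + _).
  under eq_bigr do rewrite row_mxEl.
  by rewrite IHr; apply: eq_bigr => i _; rewrite mxE.
by apply: eq_bigr => i _; rewrite row_mxEr !mxE sqrrN.
Qed.

Lemma cd_mul_conj r (x : cd R r) :
  cd_mul x (cd_conj x) = (enorm x ^+ 2) *: cd_one r.
Proof.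
elim: r x => [|r IHr] x /=.
  by apply/rowP => j; rewrite (@enorm_cdE 0) !mxE (ord1 j) big_ord1 mulr1 expr2.
rewrite row_mxKl row_mxKr cd_conjK cd_conjN !(cd_mulN _ _).2 IHr opprK.
rewrite -{2}(cd_conjK (rsubmx _)) IHr enorm_conj addNr -scalerDl.
rewrite scale_row_mx scaler0; congr (row_mx (_ *: _) _).
rewrite (@enorm_cdE r.+1) !enorm_cdE [RHS]big_split_ord /=; congr (_ + _).
  by apply: eq_bigr => j _; rewrite !mxE.
by apply: eq_bigr => j _; rewrite !mxE.
Qed.

End CayleyDickson.

Section Phrases.
Variables (R : realType) (r n : nat).

(* Bracketed words in the letters _jz (Letter false j), their conjugates
   (Letter true j) and constants. *)
Inductive word : Type :=
  | Letter of bool & 'I_n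
  | Const of cd R r
  | Mul of word & word.

Fixpoint word_eval (w : word) (z : cdn R r n) : cd R r :=
  match w with
  | Letter c j => if c then cd_conj (row j z) else row j z
  | Const a => a
  | Mul u v => cd_mul (word_eval u z) (word_eval v z)
  end.

(* (partial w / partial _jz).h for c = false, and
   (partial w / partial _jz~).h for c = true; in particular the derivative of
   the letter _jz~ by itself is h |-> h~, so that the two partial derivatives
   add up to the derivative in the real sense. *)
Fixpoint word_deriv (c : bool) (j : 'I_n) (w : word) (z : cdn R r n)
    (h : cd R r) : cd R r :=
  match w with
  | Letter c' j' =>
      if (c' == c) && (j' == j) then (if c then cd_conj h else h) else 0
  | Const _ => 0
  | Mul u v => cd_mul (word_deriv c j u z h) (word_eval v z)
             + cd_mul (word_eval u z) (word_deriv c j v z h)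
  end.

(* A phrase is a (finite or infinite) sum of words; finite sums are padded with
   Const 0.  Near the point xi it is taken as a power series, i.e. its letters
   are evaluated at z - xi; the words come in no canonical order, so
   convergence means absolute convergence. *)
Definition phrase := nat -> word.

Definition represents (P : phrase) (f : cdn R r n -> cd R r) (xi : cdn R r n) :=
  \forall z \near xi,
    cvg ([normed series (fun k => word_eval (P k) (z - xi))] @ \oo) /\
    series (fun k => word_eval (P k) (z - xi)) @ \oo --> f z.

Definition phrase_deriv (c : bool) (j : 'I_n) (P : phrase) (zeta : cdn R r n)
    (A : cd R r -> cd R r) :=
  forall h, series (fun k => word_deriv c j (P k) zeta h) @ \oo --> A h.

(* A and B are the partial derivatives of f by _jz and by _jz~ at xi.  They
   depend on the representing phrase, only A + B being determined by the
   function f; so the derivative by _jz is always considered below together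
   with the requirement B = 0. *)
Definition superderivatives (f : cdn R r n -> cd R r) (xi : cdn R r n)
    (j : 'I_n) (A B : cd R r -> cd R r) :=
  differentiable f xi /\
  exists P : phrase, [/\ represents P f xi,
    phrase_deriv false j P 0 A & phrase_deriv true j P 0 B].

Definition holomorphic (U : set (cdn R r n)) (f : cdn R r n -> cd R r) :=
  forall xi, U xi -> differentiable f xi /\
  exists P : phrase, represents P f xi /\
    \forall z \near xi, forall j, phrase_deriv true j P (z - xi) (fun=> 0).

End Phrases.

Section Pseudoconformal.
Variables (R : realType) (r : nat).

(* Functions of one variable.  Nonproper rotations are excluded by the sign of
   the determinant of the derivative as a linear operator on R^(2^r). *)
Definition pseudoconformal (f : cd R r -> cd R r) (xi : cd R r) :=
  exists A : cd R r -> cd R r,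
  [/\ @superderivatives R r 1 f xi ord0 A (fun=> 0),
      forall h1 h2,
        cd_re (cd_mul (A h1) (cd_conj (A h2))) * (enorm h1 * enorm h2) =
        enorm (A h1) * enorm (A h2) * cd_re (cd_mul h1 (cd_conj h2)),
      exists h, A h != 0 &
      0 < \det (lin1_mx A)].

(* f as a function of _jz, the other variables being those of xi *)
Definition slice (n : nat) (f : cdn R r n -> cd R r) (xi : cdn R r n)
    (j : 'I_n) (w : cd R r) : cd R r :=
  f (\matrix_(i, k) if i == j then w ord0 k else xi i k).

Definition pseudoconformal_by (n : nat) (j : 'I_n) (f : cdn R r n -> cd R r)
    (xi : cdn R r n) :=
  pseudoconformal (slice f xi j) (row j xi).

Definition zero_derivative_by (n : nat) (j : 'I_n) (f : cdn R r n -> cd R r)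
    (xi : cdn R r n) :=
  @superderivatives R r 1 (slice f xi j) (row j xi) ord0 (fun=> 0) (fun=> 0).

End Pseudoconformal.

Section Homotopy.
Variables (R : realType) (T : topologicalType).
Implicit Type W : set T.

Definition arcwise_connected W :=
  forall x y, W x -> W y -> exists g : R -> T,
    [/\ {within `[0, 1], continuous g}, g @` `[0, 1] `<=` W,
        g 0 = x & g 1 = y].

Definition cube (k : nat) : set 'rV[R]_k :=
  [set x | forall i, 0 <= x ord0 i <= 1].

Definition cube_boundary (k : nat) : set 'rV[R]_k :=
  [set x | cube x /\ exists i, x ord0 i = 0 \/ x ord0 i = 1].

(* every map (I^k, boundary of I^k) -> (W, w) is homotopic to the constant w
   through such maps *)
Definition trivial_homotopy_group (k : nat) W :=
  forall (w : T) (g : 'rV[R]_k -> T), W w ->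
    {within cube (k := k), continuous g} -> g @` cube (k := k) `<=` W ->
    (forall x, cube_boundary x -> g x = w) ->
  exists H : R * 'rV[R]_k -> T,
    [/\ {within `[0, 1] `*` cube (k := k), continuous H},
        H @` (`[0, 1] `*` cube (k := k)) `<=` W,
        forall x, cube x -> H (0, x) = g x,
        forall x, cube x -> H (1, x) = w &
        forall t x, 0 <= t <= 1 -> cube_boundary x -> H (t, x) = w].

(* arcwise connected with trivial homotopy groups in degrees 1, ..., m *)
Definition n_connected (m : nat) W :=
  arcwise_connected W /\
  forall k, (1 <= k <= m)%N -> trivial_homotopy_group k W.

Definition simply_connected W := n_connected 1 W.

End Homotopy.

Section Domains.
Variables (R : realType) (r n : nat).
Implicit Types (U V : set (cdn R r n)) (W : set (cd R r)).

Definition generator (k : 'I_(cd_dim r)) : cd R r := delta_mx ord0 k.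

Definition coord_plane (s p : 'I_(cd_dim r)) : set (cd R r) :=
  [set u | exists a b : R, u = a *: generator s + b *: generator p].

Definition coord_coplane (s p : 'I_(cd_dim r)) : set (cd R r) :=
  [set t | t ord0 s = 0 /\ t ord0 p = 0].

Definition plane_section (s p : 'I_(cd_dim r)) (t : cd R r) W : set (cd R r) :=
  [set u | coord_plane s p u /\ W (u + t)].

Definition coord_proj U (j : 'I_n) : set (cd R r) := row j @` U.

Definition domain U := [/\ U !=set0, open U & connected U].

(* The consecutive generators i_(2k), i_(2k+1) are given by indices s, p. *)
Definition domain_condition U :=
  forall j : 'I_n,
    n_connected R (2 ^ r - 1) (coord_proj U j) /\
    forall (k : nat) (s p : 'I_(cd_dim r)) (t u : cd R r),
      s = k.*2 :> nat -> p = k.*2.+1 :> nat ->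
      coord_coplane s p t -> coord_plane s p u -> coord_proj U j (u + t) ->
      simply_connected R (plane_section s p t (coord_proj U j)).

End Domains.

Section Normal.
Variables (R : realType) (r n : nat).
Implicit Types (U V : set (cdn R r n)) (f g : cdn R r n -> cd R r).

(* The derivative f' of a holomorphic function is its Frechet derivative, since
   its derivatives by the _jz~ vanish.  The maxima are taken as extended
   suprema, so that an unbounded difference gives +oo. *)
Definition deriv_dist f g (z : cdn R r n) : \bar R :=
  ereal_sup [set (enorm ('d f z h - 'd g z h))%:E |
               h in [set h : cdn R r n | enorm h = 1]].

Definition rho V f g : \bar R :=
  ereal_sup [set adde (enorm (f z - g z))%:E (deriv_dist f g z) | z in V].

(* V is nonempty because the extended supremum over the empty set is -oo.  The
   finite constants among the possible limits are constant functions g. *)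
Definition normal_family U (F : set (cdn R r n -> cd R r)) :=
  [/\ forall f, F f -> holomorphic U f,
      forall f, F f -> forall xi, U xi -> forall j,
        pseudoconformal_by j f xi \/ zero_derivative_by j f xi &
      forall f_ : nat -> cdn R r n -> cd R r, (forall k, F (f_ k)) ->
      forall V, V !=set0 -> closed V -> bounded_set V ->
        V = closure V^° -> V `<=` U ->
      exists2 phi : nat -> nat, {homo phi : i j / (i < j)%N} &
        (exists2 g, (forall z, V z -> differentiable g z) &
           rho V (f_ (phi k)) g @[k --> \oo] --> 0%E)
        \/
        (* the limit is the infinite constant *)
        (forall M : R, \forall k \near \oo,
           forall z, V z -> M <= enorm (f_ (phi k) z))].

End Normal.

(* Main.v *)
From HB Require Import structures.
Require Import Defs.
From mathcomp Require Import all_boot all_order all_algebra.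
From mathcomp Require Import all_classical all_reals all_analysis.
From mathcomp Require Import ring lra zify.

(* Every holomorphic f is real analytic: since |xy| = |x||y|, a phrase that
   converges absolutely at one point whose variables all have norm rho is
   majorized by a series that is uniform on the polydisc of radius rho.

   As a function of one variable, f is conformal wherever its derivative does
   not vanish: the columns of its Jacobian are orthogonal of equal norm,
   sqrt mu.  In dimension > 2, differentiating this twice and eliminating the
   third derivatives of f gives the flatness equations
     2 mu mu_lq = 3 mu_l mu_q - (|grad mu|^2 / 2) delta_lq,
   which say that u = 1 / sqrt mu has second derivative sigma * (identity) with
   sigma constant and 2 u sigma = |grad u|^2 (Liouville's theorem, in
   infinitesimal form).  Along a line u is thus a quadratic polynomial; so mu
   cannot reach 0 from a positive value, and in the direction of -grad u the
   polynomial has a zero at distance 2 u / |grad u|, which cannot lie in the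
   domain.  This bounds |grad mu| / mu by the distance to the boundary, hence
   the pure second derivatives of f by sqrt mu, and then sqrt mu itself by
   sup |f|.

   So a bounded family has locally uniform bounds on the first derivatives and
   on the pure second derivatives in each coordinate.  By the Landau-Kolmogorov
   interpolation argument this makes the first derivatives equicontinuous, and
   the subsequence is extracted as in the Arzela-Ascoli theorem, the limit
   being taken along an ultrafilter. *)

Set Implicit Arguments.
Unset Strict Implicit.
Unset Printing Implicit Defensive.

Import Order.TTheory GRing.Theory Num.Theory.
Import numFieldNormedType.Exports.

Local Open Scope classical_set_scope.
Local Open Scope ring_scope.

(** * Directional derivatives *)

Lemma is_derive_cvg (R : realType) (E : normedModType R) (f : E -> R) (x v : E) d :
  h^-1 *: (f (h *: v + x) - f x) @[h --> 0^'] --> d -> is_derive x v f d.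
Proof.
move=> fd; split; first by apply/cvg_ex; exists d; exact: fd.
by apply: cvg_lim => //; exact: fd.
Qed.

Lemma is_derive_cvgE (R : realType) (E : normedModType R) (f : E -> R) (x v : E) d :
  is_derive x v f d -> h^-1 *: (f (h *: v + x) - f x) @[h --> 0^'] --> d.
Proof. by case=> fd <-; exact: fd. Qed.

Section DirectionalDerivatives.
Variables (R : realType) (E : normedModType R).
Implicit Types (f g : E -> R) (x v : E).

Lemma is_derive_affine f x v d :
  (forall h, f (h *: v + x) = h * d + f x) -> is_derive x v f d.
Proof.
move=> fE; apply: is_derive_cvg; apply/cvgrPdist_le => e e0; near=> h.
have h0 : h != 0 by near: h; exact: nbhs_dnbhs_neq.
by rewrite fE addrK scalerA mulVf // scale1r subrr normr0 ltW.
Unshelve. all: by end_near. Qed.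

(** Passes to the real function along a line, where the mean value theorem is available. *)
Lemma is_derive_line f x v t d :
  is_derive (x + t *: v) v f d -> is_derive t 1 (fun s => f (x + s *: v)) d.
Proof.
move=> [fd <-]; apply: is_derive_cvg; under eq_fun do
  rewrite scalerDl addrCA [_%:A]mulr1.
exact: fd.
Qed.

Lemma is_derive_of_line f x v d :
  is_derive (0 : R) 1 (fun s => f (x + s *: v)) d -> is_derive x v f d.
Proof.
move=> /is_derive_cvgE fd; apply: is_derive_cvg; move: fd.
under eq_fun do rewrite scale0r !addr0 [_%:A]mulr1 [x + _]addrC.
exact.
Qed.

Lemma is_deriveD_fun f g x v df dg : is_derive x v f df -> is_derive x v g dg ->
  is_derive x v (fun z => f z + g z) (df + dg).
Proof. exact: is_deriveD. Qed.

Lemma is_deriveM_fun f g x v df dg : is_derive x v f df -> is_derive x v g dg ->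
  is_derive x v (fun z => f z * g z) (df * g x + f x * dg).
Proof.
move=> fd gd; have := is_deriveM fd gd; rewrite addrC.
by rewrite [g x *: df]mulrC.
Qed.

Lemma is_derive_sum_fun m (f : 'I_m -> E -> R) x v df :
  (forall i, is_derive x v (f i) (df i)) ->
  is_derive x v (fun z => \sum_i f i z) (\sum_i df i).
Proof.
move=> /is_derive_sum; congr (is_derive _ _ _ _).
by apply/funext => z; rewrite fct_sumE.
Qed.

End DirectionalDerivatives.

(** * Cayley-Dickson algebras and the Euclidean norm *)

Section CayleyDicksonNorm.
Variable R : realType.

Definition dot d (x y : 'rV[R]_d) : R := \sum_j x ord0 j * y ord0 j.

Lemma dotC d (x y : 'rV[R]_d) : dot x y = dot y x.
Proof. by apply: eq_bigr => j _; rewrite mulrC. Qed.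

Lemma dotDl d (x y z : 'rV[R]_d) : dot (x + y) z = dot x z + dot y z.
Proof. by rewrite -big_split; apply: eq_bigr => j _; rewrite mxE mulrDl. Qed.

Lemma dotNl d (x z : 'rV[R]_d) : dot (- x) z = - dot x z.
Proof. by rewrite -sumrN; apply: eq_bigr => j _; rewrite mxE mulNr. Qed.

Lemma dotDr d (x y z : 'rV[R]_d) : dot z (x + y) = dot z x + dot z y.
Proof. by rewrite !(dotC z) dotDl. Qed.

Lemma dotNr d (x z : 'rV[R]_d) : dot z (- x) = - dot z x.
Proof. by rewrite !(dotC z) dotNl. Qed.

Lemma dot_row_mx m d (a c : 'rV[R]_m) (b e : 'rV[R]_d) :
  dot (row_mx a b) (row_mx c e) = dot a c + dot b e.
Proof.
rewrite /dot big_split_ord /=; congr (_ + _).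
  by apply: eq_bigr => i _; rewrite !row_mxEl.
by apply: eq_bigr => i _; rewrite !row_mxEr.
Qed.

Lemma enorm_sqr d (x : 'rV[R]_d) : enorm x ^+ 2 = dot x x.
Proof.
rewrite /enorm sqr_sqrtr big_ord1; first by apply: eq_bigr => j _.
by apply: sumr_ge0 => j _; rewrite sqr_ge0.
Qed.

Lemma enorm_ge0 m d (x : 'M[R]_(m, d)) : 0 <= enorm x.
Proof. exact: sqrtr_ge0. Qed.

Lemma cd_conjD r (x y : 'rV[R]_(cd_dim r)) :
  cd_conj (x + y) = cd_conj x + cd_conj y.
Proof.
elim: r x y => //= r IHr x y.
by rewrite !linearD /= IHr add_row_mx.
Qed.

Lemma cd_conjZ r a (x : 'rV[R]_(cd_dim r)) :
  cd_conj (a *: x) = a *: cd_conj x.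
Proof.
elim: r x => //= r IHr x.
by rewrite !linearZ /= IHr scale_row_mx scalerN.
Qed.

(** Both sides at once: in the doubling formula the halves of either factor occur on the left of
    some products and on the right of others, so the induction needs linearity in both arguments. *)
Lemma cd_mul_lin r (a : R) (x y z : 'rV[R]_(cd_dim r)) :
  cd_mul (a *: x + y) z = a *: cd_mul x z + cd_mul y z /\
  cd_mul z (a *: x + y) = a *: cd_mul z x + cd_mul z y.
Proof.
elim: r x y z => [|r IHr] x y z /=.
  by split; apply/rowP => j; rewrite !mxE; ring.
rewrite !linearP /= !cd_conjD !cd_conjZ !(IHr _ _ _).1 !(IHr _ _ _).2.
rewrite !scale_row_mx !add_row_mx.
by split; congr row_mx; apply/rowP => j; rewrite !mxE; ring.
Qed.

Lemma cd_mulDl r (x y z : 'rV[R]_(cd_dim r)) :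
  cd_mul (x + y) z = cd_mul x z + cd_mul y z.
Proof. by have [+ _] := cd_mul_lin 1 x y z; rewrite !scale1r. Qed.

Lemma cd_mulDr r (x y z : 'rV[R]_(cd_dim r)) :
  cd_mul z (x + y) = cd_mul z x + cd_mul z y.
Proof. by have [_] := cd_mul_lin 1 x y z; rewrite !scale1r. Qed.

Lemma cd_mul0 r (x : 'rV[R]_(cd_dim r)) : cd_mul 0 x = 0 /\ cd_mul x 0 = 0.
Proof.
have [] := cd_mul_lin (- 1) 0 0 x.
by rewrite scaler0 addr0 !scaleN1r !addNr.
Qed.

Lemma cd_mulZl r a (x z : 'rV[R]_(cd_dim r)) :
  cd_mul (a *: x) z = a *: cd_mul x z.
Proof.
by have [+ _] := cd_mul_lin a x 0 z; rewrite !addr0 (cd_mul0 _).1 addr0.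
Qed.

Lemma cd_mulZr r a (x z : 'rV[R]_(cd_dim r)) :
  cd_mul z (a *: x) = a *: cd_mul z x.
Proof.
by have [_] := cd_mul_lin a x 0 z; rewrite !addr0 (cd_mul0 _).2 addr0.
Qed.

Lemma cd_conj_mul r (x y : 'rV[R]_(cd_dim r)) :
  cd_conj (cd_mul x y) = cd_mul (cd_conj y) (cd_conj x).
Proof.
elim: r x y => [|r IHr] x y /=.
  by apply/rowP => j; rewrite !mxE mulrC.
rewrite !row_mxKl !row_mxKr cd_conjD !cd_conjN !IHr !cd_conjK.
rewrite !(cd_mulN _ _).1 !(cd_mulN _ _).2.
by congr row_mx; apply/rowP => j; rewrite !mxE; ring.
Qed.

Lemma dot_conj r (x y : 'rV[R]_(cd_dim r)) :
  dot (cd_conj x) (cd_conj y) = dot x y.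
Proof.
elim: r x y => //= r IHr x y.
rewrite dot_row_mx IHr dotNl dotNr opprK -dot_row_mx.
by rewrite !hsubmxK.
Qed.

Lemma cd_reD r (x y : 'rV[R]_(cd_dim r)) : cd_re (x + y) = cd_re x + cd_re y.
Proof. by elim: r x y => [|r IHr] x y /=; rewrite ?mxE // linearD IHr. Qed.

Lemma cd_reN r (x : 'rV[R]_(cd_dim r)) : cd_re (- x) = - cd_re x.
Proof. by elim: r x => [|r IHr] x /=; rewrite ?mxE // linearN IHr. Qed.

Lemma cd_re_mul r (x y : 'rV[R]_(cd_dim r)) :
  cd_re (cd_mul x y) = dot x (cd_conj y).
Proof.
elim: r x y => [|r IHr] x y /=; first by rewrite mxE /dot big_ord1.
rewrite row_mxKl cd_reD cd_reN !IHr dot_conj.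
rewrite -{3}(hsubmxK (x : 'rV[R]_(cd_dim r + cd_dim r))) dot_row_mx dotNr.
by rewrite (dotC (rsubmx x)).
Qed.

(** Turns the angle condition of pseudoconformality into a statement on Euclidean inner products. *)
Lemma cd_re_mul_conj r (x y : 'rV[R]_(cd_dim r)) :
  cd_re (cd_mul x (cd_conj y)) = dot x y.
Proof. by rewrite cd_re_mul cd_conjK. Qed.

Lemma cd_re_mulC r (x y : 'rV[R]_(cd_dim r)) :
  cd_re (cd_mul x y) = cd_re (cd_mul y x).
Proof. by rewrite !cd_re_mul -dot_conj cd_conjK dotC. Qed.

Lemma cd_mulC_double r :
  (forall x : 'rV[R]_(cd_dim r), cd_conj x = x) ->
  (forall x y : 'rV[R]_(cd_dim r), cd_mul x y = cd_mul y x) ->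
  forall x y : 'rV[R]_(cd_dim r.+1), cd_mul x y = cd_mul y x.
Proof.
move=> conj_id mulC x y /=; rewrite !conj_id.
by congr row_mx; [congr (_ - _); exact: mulC | rewrite addrC].
Qed.

Lemma cd_mulA_double r :
  (forall x y : 'rV[R]_(cd_dim r), cd_mul x y = cd_mul y x) ->
  (forall x y z : 'rV[R]_(cd_dim r),
     cd_mul x (cd_mul y z) = cd_mul (cd_mul x y) z) ->
  forall x y z : 'rV[R]_(cd_dim r.+1),
    cd_mul x (cd_mul y z) = cd_mul (cd_mul x y) z.
Proof.
move=> mulC mulA x y z /=; rewrite !row_mxKl !row_mxKr.
move: (lsubmx x) (rsubmx x) (lsubmx y) (rsubmx y) (lsubmx z) (rsubmx z).
move=> a b c d e f.
have mulCA x1 x2 x3 : @cd_mul R r x1 (cd_mul x2 x3) = cd_mul x2 (cd_mul x1 x3).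
  by rewrite mulA (mulC x1) -mulA.
rewrite !(cd_conjD, cd_conjN, cd_conj_mul, cd_conjK).
rewrite !(cd_mulDl, cd_mulDr) !(cd_mulN _ _).1 !(cd_mulN _ _).2.
congr row_mx; rewrite -!mulA.
  rewrite (mulCA e (cd_conj d)) (mulC e b) (mulC (cd_conj f) d) (mulCA a d).
  rewrite (mulCA (cd_conj f) d) (mulC (cd_conj f) a) (mulC b (cd_conj c)).
  rewrite (mulCA (cd_conj f) (cd_conj c)).
  by apply/rowP => j; rewrite !mxE; ring.
rewrite (mulC c a) (mulC (cd_conj e) (cd_conj c)) (mulCA f (cd_conj d)).
rewrite (mulC f b) (mulCA b (cd_conj d)) (mulC (cd_conj e) a).
by apply/rowP => j; rewrite !mxE; ring.
Qed.

(** The squared norms of the two halves sum to the product, up to the cross terms <ac, d~b> and <da,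
    bc~>. By associativity both are real parts of cyclic permutations of one product, so they
    cancel. *)
Lemma cd_norm_double r :
  (forall x y z : 'rV[R]_(cd_dim r),
     cd_mul x (cd_mul y z) = cd_mul (cd_mul x y) z) ->
  (forall x y : 'rV[R]_(cd_dim r),
     dot (cd_mul x y) (cd_mul x y) = dot x x * dot y y) ->
  forall x y : 'rV[R]_(cd_dim r.+1),
    dot (cd_mul x y) (cd_mul x y) = dot x x * dot y y.
Proof.
move=> mulA norm_mul x y /=; rewrite dot_row_mx.
have dotE (u : 'rV[R]_(cd_dim r + cd_dim r)) :
    dot u u = dot (lsubmx u) (lsubmx u) + dot (rsubmx u) (rsubmx u).
  by rewrite -dot_row_mx hsubmxK.
rewrite (dotE x) (dotE y).
move: (lsubmx x) (rsubmx x) (lsubmx y) (rsubmx y) => a b c d.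
rewrite !(dotDl, dotDr, dotNl, dotNr) !norm_mul !dot_conj.
have -> : dot (cd_mul a c) (cd_mul (cd_conj d) b) =
          dot (cd_mul d a) (cd_mul b (cd_conj c)).
  rewrite -!cd_re_mul_conj !cd_conj_mul !cd_conjK !mulA cd_re_mulC.
  by rewrite !mulA.
rewrite (dotC (cd_mul (cd_conj d) b)) (dotC (cd_mul b (cd_conj c))).
have -> : dot (cd_mul a c) (cd_mul (cd_conj d) b) =
          dot (cd_mul d a) (cd_mul b (cd_conj c)).
  rewrite -!cd_re_mul_conj !cd_conj_mul !cd_conjK !mulA cd_re_mulC.
  by rewrite !mulA.
ring.
Qed.

(** Climbs through R, C, H, O. Each doubling costs a property: a commutative level with trivial
    conjugation gives a commutative one, a commutative associative level an associative one, an
    associative level a multiplicative norm. *)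
Lemma enorm_cd_mul r (x y : 'rV[R]_(cd_dim r)) : (r <= 3)%N ->
  enorm (cd_mul x y) = enorm x * enorm y.
Proof.
have mulC0 (u v : 'rV[R]_(cd_dim 0)) : cd_mul u v = cd_mul v u.
  by apply/rowP => j; rewrite !mxE mulrC.
have mulA0 (u v w : 'rV[R]_(cd_dim 0)) :
    cd_mul u (cd_mul v w) = cd_mul (cd_mul u v) w.
  by apply/rowP => j; rewrite !mxE mulrA.
have mulA1 := cd_mulA_double mulC0 mulA0.
have mulC1 := @cd_mulC_double 0 (fun=> erefl) mulC0.
have mulA2 := cd_mulA_double mulC1 mulA1.
have norm0 (u v : 'rV[R]_(cd_dim 0)) :
    dot (cd_mul u v) (cd_mul u v) = dot u u * dot v v.
  by rewrite /dot !big_ord1 !mxE; ring.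
have norm1 := cd_norm_double mulA0 norm0.
have norm2 := cd_norm_double mulA1 norm1.
have norm3 := cd_norm_double mulA2 norm2.
move=> r_le3; apply/eqP.
rewrite -(@eqrXn2 _ 2) ?mulr_ge0 ?enorm_ge0 // exprMn !enorm_sqr; apply/eqP.
by move: r r_le3 x y => [|[|[|[|r]]]].
Qed.

Lemma enorm_coord_le m d (x : 'M[R]_(m, d)) i j : `|x i j| <= enorm x.
Proof.
rewrite -sqrtr_sqr ler_wsqrtr // (bigD1 i) //= (bigD1 j) //= -addrA lerDl.
by rewrite addr_ge0 // ?sumr_ge0 // => k _; rewrite ?sqr_ge0 // sumr_ge0 // => l _;
  rewrite sqr_ge0.
Qed.

Lemma mx_coord_le m d (x : 'M[R]_(m, d)) i j : `|x i j| <= `|x|.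
Proof.
by rewrite [leRHS]/Num.Def.normr /= mx_normrE; exact: (le_bigmax _ _ (i, j)).
Qed.

Lemma mx_norm_le m d (x : 'M[R]_(m, d)) e : 0 <= e ->
  (forall i j, `|x i j| <= e) -> `|x| <= e.
Proof.
move=> e0 xe; rewrite [leLHS]/Num.Def.normr /= mx_normrE.
by apply: bigmax_le => // -[i j] _; exact: xe.
Qed.

Lemma enorm_le_coord m d (x : 'M[R]_(m, d)) e : 0 <= e ->
  (forall i j, `|x i j| <= e) -> enorm x <= (m * d)%:R * e.
Proof.
move=> e0 xe; 
rewrite -[leRHS]ger0_norm ?mulr_ge0 // -sqrtr_sqr ler_wsqrtr //.
apply: (@le_trans _ _ (\sum_(i < m) \sum_(j < d) e ^+ 2)).
  apply: ler_sum => i _; apply: ler_sum => j _.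
  by rewrite -real_normK ?num_real // lerXn2r ?nnegrE.
rewrite !sumr_const !card_ord -mulrnA exprMn -[leLHS]mulr_natl.
rewrite ler_wpM2r ?sqr_ge0 //.
(* The factor [m * d] is cruder than its square root; the bound is [m * d <= (m * d) ^ 2]. *)
rewrite -natrX ler_nat mulnC; case: (m * d)%N => // k.
by rewrite expnS expn1 leq_pmulr.
Qed.

Lemma enorm_le_mx_norm m d (x : 'M[R]_(m, d)) : enorm x <= (m * d)%:R * `|x|.
Proof. by apply: enorm_le_coord => // i j; exact: mx_coord_le. Qed.

Lemma enorm_eq0 m d (x : 'M[R]_(m, d)) : enorm x = 0 -> x = 0.
Proof.
move=> x0; apply/matrixP => i j; rewrite mxE; apply/eqP.
by rewrite -normr_le0 -x0 enorm_coord_le.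
Qed.

Lemma enorm0 m d : enorm (0 : 'M[R]_(m, d)) = 0.
Proof.
rewrite /enorm big1 ?sqrtr0 // => i _; rewrite big1 // => j _.
by rewrite mxE expr0n.
Qed.

Lemma enorm_delta m d i j : enorm (delta_mx i j : 'M[R]_(m, d)) = 1.
Proof.
rewrite /enorm (bigD1 i) //= [X in _ + X]big1 ?addr0 => [|k /negPf ki].
  rewrite (bigD1 j) //= big1 ?addr0 => [|l /negPf lj].
    by rewrite mxE !eqxx expr1n sqrtr1.
  by rewrite mxE lj andbF expr0n.
by rewrite big1 // => l _; rewrite mxE ki expr0n.
Qed.

Lemma dot_le_enorm d (x y : 'rV[R]_d) : dot x y <= enorm x * enorm y.
Proof.
have [x0|x0] := eqVneq (enorm x) 0.
  rewrite x0 mul0r (enorm_eq0 x0) /dot big1 // => j _.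
  by rewrite mxE mul0r.
have [y0|y0] := eqVneq (enorm y) 0.
  rewrite y0 mulr0 (enorm_eq0 y0) /dot big1 // => j _.
  by rewrite mxE mulr0.
have xy_gt0 : 0 < enorm x * enorm y.
  by rewrite mulr_gt0 // lt0r enorm_ge0 ?x0 ?y0.
(* Cauchy-Schwarz, from the squared norm of |y| x - |x| y. *)
have : 0 <= \sum_j (enorm y * x ord0 j - enorm x * y ord0 j) ^+ 2.
  by apply: sumr_ge0 => j _; rewrite sqr_ge0.
have -> : \sum_j (enorm y * x ord0 j - enorm x * y ord0 j) ^+ 2 =
    enorm y ^+ 2 * dot x x + enorm x ^+ 2 * dot y y -
    2 * (enorm x * enorm y) * dot x y.
  rewrite /dot !mulr_sumr -big_split -sumrB /=; apply: eq_bigr => j _; ring.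
rewrite -!enorm_sqr => le0.
rewrite -(ler_pM2l xy_gt0); nra.
Qed.

Lemma ler_enormD d (x y : 'rV[R]_d) : enorm (x + y) <= enorm x + enorm y.
Proof.
rewrite -ler_sqr ?nnegrE ?addr_ge0 ?enorm_ge0 // sqrrD !enorm_sqr.
rewrite dotDl !dotDr (dotC y x); have := dot_le_enorm x y; lra.
Qed.

Lemma enormZ m d a (x : 'M[R]_(m, d)) : enorm (a *: x) = `|a| * enorm x.
Proof.
rewrite /enorm -sqrtr_sqr -sqrtrM ?sqr_ge0 //; congr Num.sqrt.
rewrite mulr_sumr; apply: eq_bigr => i _; rewrite mulr_sumr.
by apply: eq_bigr => j _; rewrite mxE exprMn.
Qed.

Lemma enormN m d (x : 'M[R]_(m, d)) : enorm (- x) = enorm x.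
Proof. by rewrite -scaleN1r enormZ normrN1 mul1r. Qed.

Lemma enorm_cd_conj r (x : 'rV[R]_(cd_dim r)) : enorm (cd_conj x) = enorm x.
Proof.
by apply/eqP; rewrite -(@eqrXn2 _ 2) ?enorm_ge0 // enorm_conj.
Qed.

End CayleyDicksonNorm.

(** * Termwise differentiation *)

Section Termwise.
Variable R : realType.

Lemma mvt_le (f df : R -> R) (a b B : R) : a <= b ->
  (forall x, a <= x <= b -> is_derive x 1 f (df x)) ->
  (forall x, a <= x <= b -> `|df x| <= B) ->
  `|f b - f a| <= B * (b - a).
Proof.
move=> ab fd dB.
have [||c + ->] := @MVT_segment R f df a b ab.
- by move=> x; rewrite in_itv /= => /andP[/ltW ax /ltW xb]; apply: fd; rewrite ax.
- apply: derivable_within_continuous => x; rewrite in_itv /= => xab.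
  exact: @ex_derive _ _ _ _ _ _ _ (fd x xab).
- rewrite in_itv /= => cab; rewrite normrM (ger0_norm (x := b - a)) ?subr_ge0 //.
  by rewrite ler_wpM2r ?subr_ge0 ?dB.
Qed.

Lemma mvt_le_sym (f df : R -> R) (r h B : R) : `|h| <= r ->
  (forall x : R, `|x| <= r -> is_derive x 1 f (df x)) ->
  (forall x : R, `|x| <= r -> `|df x| <= B) ->
  `|f h - f 0| <= B * `|h|.
Proof.
move=> hr fd dB; have [h0|h0] := leP 0 h.
  rewrite (ger0_norm h0) -[X in B * X]subr0; rewrite (ger0_norm h0) in hr.
  apply: (@mvt_le f df) => // x /andP[x0 xh]; [apply: fd|apply: dB];
    by rewrite ger0_norm ?(le_trans xh).
rewrite (ltr0_norm h0) distrC -[X in B * X]add0r; rewrite (ltr0_norm h0) in hr.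
apply: (@mvt_le f df); first exact: ltW.
  by move=> x /andP[x0 xh]; apply: fd; rewrite ler0_norm // (le_trans _ hr) // lerN2.
by move=> x /andP[x0 xh]; apply: dB; rewrite ler0_norm // (le_trans _ hr) // lerN2.
Qed.

(** The tails of the series of [b] bound the remainders of the differentiated series, and by the
    mean value theorem also the difference quotients of the remainders of [F], uniformly in the
    increment. *)
Lemma is_derive_series (u du : nat -> R -> R) (b : nat -> R) (F : R -> R) (r : R) :
  0 < r ->
  (forall k (x : R), `|x| <= r -> is_derive x 1 (u k) (du k x)) ->
  (forall k (x : R), `|x| <= r -> `|du k x| <= b k) ->
  cvgn (series b) ->
  (forall x : R, `|x| <= r -> series (u^~ x) @ \oo --> F x) ->
  cvgn (series (du^~ 0)) /\
  is_derive (0 : R) 1 F (limn (series (du^~ 0))).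
Proof.
move=> r0 ud dub cb uF.
have b_ge0 k : 0 <= b k.
  by rewrite (le_trans (normr_ge0 _) (dub k 0 _)) // normr0 ltW.
have cdu : cvgn (series (du^~ 0)).
  apply: normed_cvg; apply: series_le_cvg cb => // k; first exact: normr_ge0.
  by apply: dub; rewrite normr0 ltW.
split; first exact: cdu.
set s := limn _.
pose T N := limn (series b) - series b N.
have T0 : T @ \oo --> 0.
  rewrite -(subrr (limn (series b))); apply: cvgB; [exact: cvg_cst|exact: cb].
have bT N M : (N <= M)%N -> series b M - series b N <= T N.
  move=> NM; rewrite lerB // nondecreasing_cvgn_le //.
  by apply: nondecreasing_series.
have sT N : `|s - series (du^~ 0) N| <= T N.
  have : (fun M => `|series (du^~ 0) M - series (du^~ 0) N|) @ \oo -->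
      `|s - series (du^~ 0) N|.
    by apply: cvg_norm; apply: cvgB; [exact: cdu|exact: cvg_cst].
  move=> /cvgr_to_le; apply; near=> M.
  have NM : (N <= M)%N by near: M; exact: nbhs_infty_ge.
  apply: le_trans (bT _ _ NM); rewrite !sub_series_geq //.
  by apply: le_trans (ler_norm_sum _ _ _) _; apply: ler_sum => k _; apply: dub;
    rewrite normr0 ltW.
(* The mean value theorem is applied to each term between [N] and [M], and then [M] tends to
   infinity. *)
have FT N h : `|h| <= r ->
    `|(F h - F 0) - (series (u^~ h) N - series (u^~ 0) N)| <= T N * `|h|.
  move=> hr.
  have : (fun M => `|(series (u^~ h) M - series (u^~ 0) M) -
                     (series (u^~ h) N - series (u^~ 0) N)|) @ \oo -->
      `|(F h - F 0) - (series (u^~ h) N - series (u^~ 0) N)|.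
    apply: cvg_norm; apply: cvgB; last exact: cvg_cst.
    by apply: cvgB; apply: uF => //; rewrite normr0 ltW.
  move=> /cvgr_to_le; apply; near=> M.
  have NM : (N <= M)%N by near: M; exact: nbhs_infty_ge.
  rewrite (_ : _ - _ = (series (u^~ h) M - series (u^~ h) N) -
    (series (u^~ 0) M - series (u^~ 0) N)); last by ring.
  rewrite !sub_series_geq // -sumrB.
  apply: le_trans (ler_norm_sum _ _ _) _.
  apply: (@le_trans _ _ (\sum_(N <= k < M) b k * `|h|)).
    apply: ler_sum => k _; apply: (@mvt_le_sym (u k) (du k) r) => // x xr.
    exact: dub.
  by rewrite -mulr_suml ler_wpM2r // -sub_series_geq // bT.
apply: is_derive_cvg; apply/cvgrPdist_le => e e0.
(* Three errors of at most [e / 4] will be added: the tail of the derivatives, the tail of the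
   difference quotients, and the finite sum up to this [N]. *)
have [N TN] : exists N, T N <= e / 4.
  move/cvgrPdist_le : T0 => /(_ (e / 4)) []; first by lra.
  by move=> N _ /(_ N (leqnn _)); rewrite sub0r normrN => /ler_normlW; exists N.
have SN : is_derive (0 : R) 1 (fun x => series (u^~ x) N) (series (du^~ 0) N).
  rewrite /series /= (_ : (fun x => _) = fun x => \sum_(k < N) u k x); last first.
    by apply/funext => x; rewrite big_mkord.
  rewrite big_mkord; apply: is_derive_sum_fun => k; apply: ud.
  by rewrite normr0 ltW.
have Sl := is_derive_cvgE SN.
move/cvgrPdist_le : Sl => /(_ (e / 4)) Sl; near=> h.
have h0 : h != 0 by near: h; exact: nbhs_dnbhs_neq.
have hr : `|h| <= r.
  by near: h; apply: (@dnbhs0_le _ R^o).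
have SNh : `|series (du^~ 0) N - h^-1 * (series (u^~ h) N - series (u^~ 0) N)|
    <= e / 4.
  have : `|series (du^~ 0) N -
      h^-1 *: (series (u^~ (h *: 1 + 0)) N - series (u^~ 0) N)| <= e / 4.
    by near: h; apply: Sl; lra.
  by rewrite addr0 [_%:A]mulr1.
have FTh : `|h^-1 * (F h - F 0) - h^-1 * (series (u^~ h) N - series (u^~ 0) N)|
    <= T N.
  rewrite -mulrBr normrM normfV mulrC ler_pdivrMr ?normr_gt0 //; exact: FT.
rewrite addr0 [_%:A]mulr1.
change (h^-1 *: (F h - F 0)) with (h^-1 * (F h - F 0)).
move: (sT N) SNh FTh (TN); rewrite !ler_norml; lra.
Unshelve. all: by end_near. Qed.

End Termwise.

(** * Analyticity of phrases *)

Section Terms.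
Variables (R : realType) (r n : nat).
Hypothesis r_le3 : (r <= 3)%N.
Local Notation V := 'rV[R]_(cd_dim r).
Local Notation E := 'M[R]_(n, cd_dim r).

(** Words enlarged by sums, so that the product rule keeps a derivative within the same syntax and
    derivatives of any order can be taken. *)
Inductive term : Type :=
  | TLetter of bool & 'I_n
  | TConst of V
  | TMul of term & term
  | TAdd of term & term.

Definition conj_if (c : bool) (x : V) : V := if c then cd_conj x else x.

Fixpoint teval (t : term) (z : E) : V :=
  match t with
  | TLetter c j => conj_if c (row j z)
  | TConst a => a
  | TMul u v => cd_mul (teval u z) (teval v z)
  | TAdd u v => teval u z + teval v z
  end.

Fixpoint tderiv (h : E) (t : term) : term :=
  match t with
  | TLetter c j => TConst (conj_if c (row j h))
  | TConst _ => TConst 0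
  | TMul u v => TAdd (TMul (tderiv h u) v) (TMul u (tderiv h v))
  | TAdd u v => TAdd (tderiv h u) (tderiv h v)
  end.

(** A majorant of the norm of [teval] on the polydisc of radius [rho]. *)
Fixpoint tmaj (rho : R) (t : term) : R :=
  match t with
  | TLetter _ _ => rho
  | TConst a => enorm a
  | TMul u v => tmaj rho u * tmaj rho v
  | TAdd u v => tmaj rho u + tmaj rho v
  end.

Lemma conj_ifP c a (x y : V) :
  conj_if c (a *: x + y) = a *: conj_if c x + conj_if c y.
Proof. by case: c => //=; rewrite cd_conjD cd_conjZ. Qed.

Lemma enorm_conj_if c (x : V) : enorm (conj_if c x) = enorm x.
Proof. by case: c; rewrite //= enorm_cd_conj. Qed.

Lemma tmaj_ge0 rho t : 0 <= rho -> 0 <= tmaj rho t.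
Proof.
move=> rho0; elim: t => //= [a|u IHu v IHv|u IHu v IHv].
- exact: enorm_ge0.
- exact: mulr_ge0.
- exact: addr_ge0.
Qed.

Lemma teval_le rho t (z : E) : (forall j, enorm (row j z) <= rho) ->
  enorm (teval t z) <= tmaj rho t.
Proof.
move=> zrho; elim: t => //= [c j|u IHu v IHv|u IHu v IHv].
- by rewrite enorm_conj_if.
- by rewrite enorm_cd_mul // ler_pM ?enorm_ge0.
- by apply: le_trans (ler_enormD _ _) _; exact: lerD.
Qed.

(* A majorant is a polynomial in the radius with nonnegative coefficients,
   hence convex. *)
Lemma tmaj_deriv rho rho' H (h : E) t : 0 <= rho' <= rho -> 0 < H ->
  (forall j, enorm (row j h) <= H) ->
  H * tmaj rho' t + (rho - rho') * tmaj rho' (tderiv h t) <= H * tmaj rho t.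
Proof.
move=> /andP[rho'0 rhorho'] H0 hH.
elim: t => //= [c j|a|u IHu v IHv|u IHu v IHv]; last 1 first.
- lra.
- rewrite enorm_conj_if; have := hH j; nra.
- by rewrite enorm0 mulr0 addr0.
- have u0 := tmaj_ge0 u rho'0; have v0 := tmaj_ge0 v rho'0.
  have du0 := tmaj_ge0 (tderiv h u) rho'0.
  have dv0 := tmaj_ge0 (tderiv h v) rho'0.
  rewrite -(ler_pM2l H0).
  (* The product of the two induction bounds exceeds the left side only by the term of second order
     in [rho - rho'], which is nonnegative. *)
  apply: (@le_trans _ _ ((H * tmaj rho' u + (rho - rho') * tmaj rho' (tderiv h u)) *
     (H * tmaj rho' v + (rho - rho') * tmaj rho' (tderiv h v)))).
    rewrite -subr_ge0 (_ : _ - _ = (rho - rho') ^+ 2 *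
      (tmaj rho' (tderiv h u) * tmaj rho' (tderiv h v))); last by ring.
    by rewrite mulr_ge0 ?sqr_ge0 ?mulr_ge0.
  rewrite (_ : H * (H * _) = (H * tmaj rho u) * (H * tmaj rho v)); last by ring.
  by apply: ler_pM => //; rewrite addr_ge0 ?mulr_ge0 ?subr_ge0 // ltW.
Qed.

Lemma tderivP a (h k : E) t z :
  teval (tderiv (a *: h + k) t) z =
  a *: teval (tderiv h t) z + teval (tderiv k t) z.
Proof.
elim: t => /= [c j|b|u IHu v IHv|u IHu v IHv].
- by rewrite linearP /= conj_ifP.
- by rewrite scaler0 addr0.
- rewrite IHu IHv cd_mulDl cd_mulDr cd_mulZl cd_mulZr.
  by apply/rowP => l; rewrite !mxE; ring.
- by rewrite IHu IHv; apply/rowP => l; rewrite !mxE; ring.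
Qed.

Lemma tderivC (h k : E) t z :
  teval (tderiv h (tderiv k t)) z = teval (tderiv k (tderiv h t)) z.
Proof.
elim: t => //= [u IHu v IHv|u IHu v IHv]; rewrite IHu IHv //.
by apply/rowP => l; rewrite !mxE; ring.
Qed.

(** The product in terms of its structure constants, which reduces the differentiation of [teval] to
    the product rule for real functions. *)
Lemma cd_mul_coord (x y : V) i : cd_mul x y ord0 i =
  \sum_a \sum_b x ord0 a * y ord0 b * cd_mul (delta_mx ord0 a : V) (delta_mx ord0 b) ord0 i.
Proof.
have mul_suml (I : Type) (s : seq I) (F : I -> V) (u : V) :
    cd_mul (\sum_(k <- s) F k) u = \sum_(k <- s) cd_mul (F k) u.
  elim: s => [|k s IHs]; first by rewrite !big_nil (cd_mul0 _).1.
  by rewrite !big_cons cd_mulDl IHs.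
have mul_sumr (I : Type) (s : seq I) (F : I -> V) (u : V) :
    cd_mul u (\sum_(k <- s) F k) = \sum_(k <- s) cd_mul u (F k).
  elim: s => [|k s IHs]; first by rewrite !big_nil (cd_mul0 _).2.
  by rewrite !big_cons cd_mulDr IHs.
rewrite [x in LHS]row_sum_delta [y in LHS]row_sum_delta mul_suml summxE.
apply: eq_bigr => a _; rewrite mul_sumr summxE; apply: eq_bigr => b _.
by rewrite cd_mulZl cd_mulZr !mxE mulrA.
Qed.

Lemma is_derive_teval t (z h : E) i :
  is_derive z h (fun z => teval t z ord0 i) (teval (tderiv h t) z ord0 i).
Proof.
elim: t i => /= [c j|a|u IHu v IHv|u IHu v IHv] i.
- apply: is_derive_affine => s.
  by rewrite linearP /= conj_ifP !mxE.
- by rewrite mxE; exact: is_derive_cst.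
- rewrite mxE !cd_mul_coord -big_split /=.
  under eq_fun do rewrite cd_mul_coord.
  apply: is_derive_sum_fun => a; rewrite -big_split /=.
  apply: is_derive_sum_fun => b; rewrite -mulrDl.
  have := is_deriveM_fun (is_deriveM_fun (IHu a) (IHv b))
    (is_derive_cst (cd_mul (delta_mx ord0 a : V) (delta_mx ord0 b) ord0 i) z h).
  by rewrite mulr0 addr0.
- rewrite mxE; under eq_fun do rewrite mxE.
  exact: is_deriveD_fun.
Qed.

(** The expansion at [xi] of a real function as coordinate [i] of a series of terms. Convergence of
    the majorants at the radius [rho] makes it uniform on the polydisc. *)
Definition term_series (w : nat -> term) (i : 'I_(cd_dim r)) (rho : R)
    (g : E -> R) (xi : E) :=
  [/\ 0 < rho, cvgn (series (fun k => tmaj rho (w k))) &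
      forall z, (forall j, enorm (row j (z - xi)) < rho) ->
        series (fun k => teval (w k) (z - xi) ord0 i) @ \oo --> g z].

(** A Cauchy estimate: shrinking the radius from [rho] to [rho'], the derivative of a term has
    majorant at most [H / (rho - rho')] times that of the term, where [H] bounds all rows of [h]. *)
Lemma tmaj_series_deriv (w : nat -> term) (rho rho' : R) (h : E) :
  0 <= rho' < rho -> cvgn (series (fun k => tmaj rho (w k))) ->
  cvgn (series (fun k => tmaj rho' (tderiv h (w k)))).
Proof.
move=> /andP[rho'0 rho'rho] cw.
pose H : R := 1 + \sum_j enorm (row j h).
have H0 : 0 < H by rewrite ltr_wpDr // sumr_ge0 // => j _; exact: enorm_ge0.
have hH j : enorm (row j h) <= H.
  rewrite /H (bigD1 j) //= addrCA lerDl addr_ge0 // sumr_ge0 // => k _.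
  exact: enorm_ge0.
have d0 : 0 < rho - rho' by rewrite subr_gt0.
apply: (@series_le_cvg _ _ (fun k => H / (rho - rho') * tmaj rho (w k))).
- by move=> k; exact: tmaj_ge0.
- move=> k; rewrite mulr_ge0 ?divr_ge0 ?(ltW H0) ?(ltW d0) //.
  by apply: tmaj_ge0; rewrite (le_trans rho'0) ?ltW.
- move=> k; rewrite mulrAC ler_pdivlMr // mulrC.
  have := @tmaj_deriv rho rho' H h (w k); rewrite rho'0 ltW // => /(_ isT H0 hH).
  apply: le_trans; rewrite lerDr mulr_ge0 ?(ltW H0) //; exact: tmaj_ge0.
- exact: is_cvg_seriesZ.
Qed.

Lemma term_series_deriv (w : nat -> term) i rho g xi h :
  term_series w i rho g xi ->
  (forall z, (forall j, enorm (row j (z - xi)) < rho / 2) ->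
    is_derive z h g (limn (series (fun k => teval (tderiv h (w k)) (z - xi) ord0 i)))) /\
  term_series (fun k => tderiv h (w k)) i (rho / 2) ('D_h g) xi.
Proof.
move=> [rho0 cw wg].
have main z : (forall j, enorm (row j (z - xi)) < rho / 2) ->
    cvgn (series (fun k => teval (tderiv h (w k)) (z - xi) ord0 i)) /\
    is_derive z h g
      (limn (series (fun k => teval (tderiv h (w k)) (z - xi) ord0 i))).
  move=> zrho.
  pose H : R := 1 + \sum_j enorm (row j h).
  have H0 : 0 < H by rewrite ltr_wpDr // sumr_ge0 // => j _; exact: enorm_ge0.
  have hH j : enorm (row j h) <= H.
    rewrite /H (bigD1 j) //= addrCA lerDl addr_ge0 // sumr_ge0 // => k _.
    exact: enorm_ge0.
  (* An increment of this size moves each variable by at most [rho / 4], from within [rho / 2] to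
     within [3 / 4 * rho]; the gap up to [rho] is left for the Cauchy estimate. *)
  have zx (x : R) j : `|x| <= rho / (4 * H) ->
      enorm (row j (z + x *: h - xi)) < 3 / 4 * rho.
    move=> xr; rewrite addrAC linearD /=; apply: le_lt_trans (ler_enormD _ _) _.
    rewrite [X in _ + enorm X]linearZ /= enormZ.
    have : `|x| * enorm (row j h) <= rho / (4 * H) * H.
      by rewrite ler_pM ?enorm_ge0.
    rewrite invfM mulrA divfK ?gt_eqF //; have := zrho j; lra.
  pose u k (x : R) := teval (w k) (z + x *: h - xi) ord0 i.
  pose du k (x : R) := teval (tderiv h (w k)) (z + x *: h - xi) ord0 i.
  have := @is_derive_series R u du
    (fun k => tmaj (3 / 4 * rho) (tderiv h (w k)))
    (fun x => g (z + x *: h)) (rho / (4 * H)).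
  case.
  - by rewrite divr_gt0 ?mulr_gt0.
  - move=> k x xr; rewrite /u /du addrAC.
    have := is_derive_teval (w k) (z - xi + x *: h) h i.
    move=> /is_derive_line; congr (is_derive _ _ _ _).
    by apply/funext => s; rewrite addrAC.
  - move=> k x xr; apply: le_trans (enorm_coord_le _ _ _) _.
    by apply: teval_le => j; rewrite ltW // zx.
  - apply: tmaj_series_deriv cw; lra.
  - by move=> x xr; apply: wg => j; apply: lt_trans (zx _ _ xr) _; lra.
  have du0 : du^~ 0 = (fun k => teval (tderiv h (w k)) (z - xi) ord0 i).
    by apply/funext => k; rewrite /du scale0r addr0.
  rewrite du0 => cdu gd; split; first exact: cdu.
  exact: is_derive_of_line.
split=> [z zrho|]; first exact: (main z zrho).2.
split.
- by rewrite divr_gt0.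
- apply: tmaj_series_deriv cw; lra.
- by move=> z zrho; have [cz [_ ->]] := main z zrho.
Qed.

(** Real analyticity in a form stable under directional derivatives, each of which halves the
    radius. *)
Definition analytic_at (g : E -> R) (xi : E) :=
  exists w i rho, term_series w i rho g xi.

Lemma row0_lt (xi : E) rho : 0 < rho -> forall j, enorm (row j (xi - xi)) < rho.
Proof. by move=> rho0 j; rewrite subrr linear0 enorm0. Qed.

Lemma analytic_at_derivable g xi h : analytic_at g xi -> derivable g xi h.
Proof.
move=> [w [i [rho wg]]]; have [rho0 _ _] := wg.
have [+ _] := term_series_deriv h wg; move=> /(_ xi) [] //.
by apply: row0_lt; rewrite divr_gt0.
Qed.

Lemma analytic_at_deriv g xi h : analytic_at g xi -> analytic_at ('D_h g) xi.
Proof.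
move=> [w [i [rho wg]]]; have [_ ?] := term_series_deriv h wg.
by exists (fun k => tderiv h (w k)), i, (rho / 2).
Qed.

Lemma term_series_lim w i rho g xi : term_series w i rho g xi ->
  series (fun k => teval (w k) 0 ord0 i) @ \oo --> g xi.
Proof. by case=> rho0 _ /(_ xi (row0_lt xi rho0)); rewrite subrr. Qed.

Lemma analytic_at_derivP g xi a h k : analytic_at g xi ->
  'D_(a *: h + k) g xi = a * 'D_h g xi + 'D_k g xi.
Proof.
move=> [w [i [rho wg]]].
have [_ /term_series_lim hk_lim] := term_series_deriv (a *: h + k) wg.
have [_ /term_series_lim h_lim] := term_series_deriv h wg.
have [_ /term_series_lim k_lim] := term_series_deriv k wg.
apply: (cvg_unique _ hk_lim) => //.
have -> : (fun l => teval (tderiv (a *: h + k) (w l)) 0 ord0 i) =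
    a *: (fun l => teval (tderiv h (w l)) 0 ord0 i : R^o) +
    (fun l => teval (tderiv k (w l)) 0 ord0 i).
  by apply/funext => l; rewrite tderivP !mxE.
rewrite seriesD seriesZ; apply: cvgD k_lim; exact: (@cvgZr _ R^o).
Qed.

(** Symmetry of second derivatives is algebraic here: [tderiv h] and [tderiv k] commute on the value
    of each term, so both iterated derivatives are limits of the same series. *)
Lemma analytic_at_derivC g xi h k : analytic_at g xi ->
  'D_h ('D_k g) xi = 'D_k ('D_h g) xi.
Proof.
move=> [w [i [rho wg]]].
have [_ /(term_series_deriv h) [_ /term_series_lim hk_lim]] := term_series_deriv k wg.
have [_ /(term_series_deriv k) [_ /term_series_lim kh_lim]] := term_series_deriv h wg.
have E : (fun l => teval (tderiv h (tderiv k (w l))) 0 ord0 i) =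
    (fun l => teval (tderiv k (tderiv h (w l))) 0 ord0 i).
  by apply/funext => l; rewrite tderivC.
rewrite E in hk_lim.
exact: (cvg_unique _ hk_lim kh_lim).
Qed.

Fixpoint term_of_word (w : word R r n) : term :=
  match w with
  | Letter c j => TLetter c j
  | Const a => TConst a
  | Mul u v => TMul (term_of_word u) (term_of_word v)
  end.

Lemma teval_term_of_word w z : teval (term_of_word w) z = word_eval w z.
Proof. by elim: w => //= u -> v ->. Qed.

(** The norm is multiplicative, so on words the majorant is attained: absolute convergence at one
    such point is convergence of the majorants. *)
Lemma tmaj_term_of_word w z rho : (forall j, enorm (row j z) = rho) ->
  tmaj rho (term_of_word w) = enorm (word_eval w z).
Proof.
move=> zrho; elim: w => //= [c j|u -> v ->]; last by rewrite enorm_cd_mul.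
by case: c; rewrite ?enorm_cd_conj zrho.
Qed.

Lemma represents_term_series (P : phrase R r n) f xi i : represents P f xi ->
  exists rho, term_series (fun k => term_of_word (P k)) i rho (fun z => f z ord0 i) xi.
Proof.
move=> /nbhs_ballP[d /= d0 Pf].
exists (d / 2).
have rho0 : 0 < d / 2 by rewrite divr_gt0.
(* A point all of whose variables have norm [d / 2], each being a multiple of one generator. *)
pose z0 : E := \matrix_(_, l) (d / 2 * (l == i)%:R).
have z0d j : enorm (row j z0) = d / 2.
  apply/eqP; rewrite -(@eqrXn2 _ 2) ?enorm_ge0 ?(ltW rho0) //; apply/eqP.
  rewrite enorm_sqr /dot (bigD1 i) //= big1 ?addr0 => [|l /negPf li].
    by rewrite !mxE eqxx mulr1 expr2.
  by rewrite !mxE li mulr0 mul0r.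
have box z : (forall j, enorm (row j (z - xi)) <= d / 2) -> ball xi d z.
  move=> zd; rewrite -ball_normE /= distrC.
  apply: (@le_lt_trans _ _ (d / 2)); last by lra.
  apply: mx_norm_le => [|j l]; first exact: ltW.
  by have := le_trans (enorm_coord_le _ ord0 l) (zd j); rewrite mxE.
split=> //.
  have [|+ _] := Pf (z0 + xi); first by apply: box => j; rewrite addrK z0d.
  rewrite addrK => cP.
  apply: (@series_le_cvg _ _
    (fun k => (1 * cd_dim r)%:R * `|word_eval (P k) z0|)).
  - by move=> k; rewrite tmaj_ge0 // ltW.
  - by move=> k; rewrite mulr_ge0.
  - by move=> k; rewrite (tmaj_term_of_word _ z0d) enorm_le_mx_norm.
  - by apply: is_cvg_seriesZ; exact: cP.
move=> z zd; have [_] := Pf z (box z (fun j => ltW (zd j))).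
move=> /(@cvg_comp _ _ _ _ (fun x : V => x ord0 i) _ _) /(_ (@coord_continuous _ _ _ _ _ _)).
have -> : (fun x : V => x ord0 i) \o series (fun k => word_eval (P k) (z - xi)) =
    series (fun k => teval (term_of_word (P k)) (z - xi) ord0 i).
  apply/funext => N; rewrite /= /series /= summxE.
  by apply: eq_bigr => k _; rewrite teval_term_of_word.
exact.
Qed.

Lemma represents_analytic_at (P : phrase R r n) f xi i : represents P f xi ->
  analytic_at (fun z => f z ord0 i) xi.
Proof.
move=> /(represents_term_series i)[rho Pf].
by exists (fun k => term_of_word (P k)), i, rho.
Qed.

End Terms.

(** The directional derivative of a word is the sum of its derivatives by the letter and by the
    conjugate letter, by induction on the word; the series is then summed. *)
Lemma superderivatives_derive (R : realType) (r : nat) (r_le3 : (r <= 3)%N)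
    (f : 'M[R]_(1, cd_dim r) -> 'rV[R]_(cd_dim r)) (xi : 'M[R]_(1, cd_dim r)) A B h i :
  @superderivatives R r 1 f xi ord0 A B ->
  'D_h (fun z => f z ord0 i) xi = (A h + B h) ord0 i.
Proof.
move=> [_ [P [Pf PA PB]]].
have [rho Pi] := represents_term_series r_le3 i Pf.
have [_ /term_series_lim h_lim] := term_series_deriv r_le3 h Pi.
pose AB := series (fun k => word_deriv false ord0 (P k) 0 h) +
  series (fun k => word_deriv true ord0 (P k) 0 h).
have AB_lim : (fun x : 'rV[R]_(cd_dim r) => x ord0 i) \o AB @ \oo -->
    (A h + B h) ord0 i.
  apply: cvg_comp; last exact: coord_continuous.
  by apply: cvgD; [exact: PA|exact: PB].
suff ABE : (fun x : 'rV[R]_(cd_dim r) => x ord0 i) \o AB =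
    series (fun k => teval (tderiv h (term_of_word (P k))) 0 ord0 i).
  by rewrite ABE in AB_lim; exact: (cvg_unique _ h_lim AB_lim).
apply/funext => N; rewrite /AB -seriesD /series /= summxE.
apply: eq_bigr => k _; congr (fun_of_matrix _ _ _).
rewrite [LHS]/(_ + _).
elim: (P k) => [c j|a|u IHu v IHv] /=.
- rewrite (ord1 j); case: c; rewrite /= row_id; [exact: add0r|exact: addr0].
- exact: addr0.
- rewrite -IHu -IHv !teval_term_of_word !cd_mulDl !cd_mulDr.
  by apply/rowP => l; rewrite !mxE; ring.
Qed.

(** * Jets of conformal maps *)

Section ConformalJet.
Variables (R : realType) (d : nat).
Hypothesis d_ge3 : (2 < d)%N.

Lemma ord_ne2 (i j : 'I_d) : exists k : 'I_d, i != k /\ j != k.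
Proof.
have : (0 < #|[set~ i] :\ j|)%N.
  by have := cardsD1 j [set~ i]; rewrite cardsC1 card_ord; case: (_ \in _); lia.
by case/card_gt0P => k; rewrite !inE => /andP[kj ki]; exists k; rewrite ![_ == k]eq_sym.
Qed.

Lemma sum_delta (i : 'I_d) (F : 'I_d -> R) : \sum_p (i == p)%:R * F p = F i.
Proof.
rewrite (bigD1 i) //= eqxx mul1r big1 ?addr0 // => p /negPf pi.
by rewrite eq_sym pi mul0r.
Qed.

(* [A], [B], [C] are the first, second and third partial derivatives of a map at
   a point, and [m], [m1], [m2] those of its squared conformal factor. *)
Variables (A : 'I_d -> 'rV[R]_d) (B : 'I_d -> 'I_d -> 'rV[R]_d).
Variables (m : R) (m1 : 'I_d -> R).
Hypothesis conf0 : forall i k, dot (A i) (A k) = m * (i == k)%:R.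
Hypothesis conf1 : forall i k l,
  dot (B i l) (A k) + dot (A i) (B k l) = m1 l * (i == k)%:R.
Hypothesis BC : forall i k, B i k = B k i.
Local Notation N := (\sum_p m1 p ^+ 2).

(** The [A p] are orthogonal of squared norm [m]: up to scaling they are an orthonormal basis, and
    if [m = 0] they all vanish. *)
Lemma conformal_parseval v w :
  m * dot v w = \sum_p dot v (A p) * dot w (A p).
Proof.
have [m0|m_neq0] := eqVneq m 0.
  rewrite m0 mul0r big1 // => p _.
  rewrite (_ : A p = 0) ?(dotC v) /dot; last first.
    by apply: enorm_eq0; apply/eqP; rewrite -sqrf_eq0 enorm_sqr conf0 m0 mul0r.
  by rewrite !big1 ?mulr0 // => k _; rewrite mxE ?mul0r ?mulr0.
pose M := \matrix_i A i.
have dotE (x y : 'rV[R]_d) : dot x y = (x *m y^T) ord0 ord0.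
  by rewrite mxE; apply: eq_bigr => k _; rewrite mxE.
have MMt : M *m (m^-1 *: M^T) = 1%:M.
  apply/matrixP => i k; rewrite -scalemxAr !mxE.
  have := conf0 i k; rewrite /dot => E.
  transitivity (m^-1 * (m * (i == k)%:R)); last by rewrite mulrA mulVf // mul1r.
  by rewrite -E; congr (_ * _); apply: eq_bigr => p _; rewrite !mxE.
(* A right inverse of a square matrix is a left inverse, so orthogonality of the rows gives that of
   the columns. *)
have MtM : M^T *m M = m *: 1%:M.
  by rewrite -(mulmx1C MMt) -scalemxAl scalerA mulfV // scale1r.
transitivity ((v *m (M^T *m M) *m w^T) ord0 ord0).
  by rewrite MtM -scalemxAr -scalemxAl mulmx1 mxE dotE.
rewrite !mulmxA -[_ *m M *m _]mulmxA mxE; apply: eq_bigr => p _.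
congr (_ * _); rewrite mxE; apply: eq_bigr => k _; rewrite !mxE //.
by rewrite mulrC.
Qed.

(** The Koszul formula for the metric m * identity: three permutations of [conf1], with the symmetry
    of [B], isolate one inner product. *)
Lemma conformal_koszul h k l : 2 * dot (B h k) (A l) =
  m1 k * (h == l)%:R + m1 h * (k == l)%:R - m1 l * (h == k)%:R.
Proof.
have := conf1 h l k; have := conf1 k l h; have := conf1 h k l.
rewrite (BC k h) (BC l k) (BC l h) ![dot (A _) _]dotC.
lra.
Qed.

(** By [conformal_koszul] the inner product of [2 * B i i] with [A p] is 2 m1_i delta_ip - m1_p; in
    the sum of the squares the terms in m1_i cancel. *)
Lemma conformal_second_norm i : 4 * m * dot (B i i) (B i i) = N.
Proof.
rewrite -mulrA conformal_parseval mulr_sumr.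
transitivity (\sum_p ((i == p)%:R * (4 * m1 i ^+ 2 * (i == p)%:R - 4 * m1 i * m1 p)
   + m1 p ^+ 2)).
  apply: eq_bigr => p _; have := conformal_koszul i i p; rewrite eqxx /= => E.
  rewrite (_ : dot _ _ = m1 i * (i == p)%:R - m1 p / 2); last by lra.
  by field.
by rewrite big_split /= sum_delta eqxx /=; ring.
Qed.

Variables (C : 'I_d -> 'I_d -> 'I_d -> 'rV[R]_d) (m2 : 'I_d -> 'I_d -> R).
Hypothesis conf2 : forall i k l q,
  dot (C i l q) (A k) + dot (B i l) (B k q) +
  (dot (B i q) (B k l) + dot (A i) (C k l q)) = m2 l q * (i == k)%:R.
Hypothesis CC1 : forall i k l, C i k l = C k i l.
Hypothesis CC2 : forall i k l, C i k l = C i l k.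

(* The combination of four instances of [conf2] in which [C] cancels. *)
Lemma conformal_flat h k l q :
  2 * dot (B h k) (B l q) - 2 * dot (B h l) (B k q) =
  m2 k q * (h == l)%:R - m2 l q * (h == k)%:R - m2 h k * (l == q)%:R +
  m2 h l * (k == q)%:R.
Proof.
have := conf2 h l k q; have := conf2 h k l q.
have := conf2 l q h k; have := conf2 k q h l.
rewrite ![dot (A _) _]dotC.
rewrite (CC1 l k q) (CC1 q h k) (CC2 h q k) (CC1 q h l) (CC2 h q l).
rewrite (CC1 l h k) (CC1 k h l) (CC2 h k l).
rewrite (BC l h) (BC q k) (BC l k) (BC q h) (BC k h) (BC q l).
rewrite (dotC (B k l)); lra.
Qed.

(** [conformal_flat] is multiplied by [m], and the inner products of second derivatives become
    quadratic in [m1] by [conformal_parseval] and the Koszul formula. Different choices of indices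
    give the diagonal and the off-diagonal equations. *)
Lemma conformal_hessian l q :
  2 * m * m2 l q = 3 * m1 l * m1 q - N / 2 * (l == q)%:R.
Proof.
have BA h k p : dot (B h k) (A p) =
    (m1 k * (h == p)%:R + m1 h * (k == p)%:R - m1 p * (h == k)%:R) / 2.
  by rewrite -conformal_koszul mulrC mulrA mulVf ?mul1r.
(* On the diagonal, flatness only shows that the defects of the equations for two distinct indices
   add up to 0. *)
have pair i j : i != j ->
    2 * m * m2 i i - 3 * m1 i ^+ 2 + N / 2 + (2 * m * m2 j j - 3 * m1 j ^+ 2 + N / 2) = 0.
  move=> /negPf ij; have ji : (j == i) = false by rewrite eq_sym.
  have := conformal_flat i i j j; rewrite ij !eqxx /= => E.
  have E1 : 4 * (m * dot (B i i) (B j j)) = N - 2 * m1 i ^+ 2 - 2 * m1 j ^+ 2.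
    rewrite conformal_parseval mulr_sumr.
    transitivity (\sum_p ((i == p)%:R * (4 * m1 i * m1 j * (j == p)%:R - 2 * m1 i * m1 p)
      + ((j == p)%:R * (- 2 * m1 j * m1 p) + m1 p ^+ 2))).
      by apply: eq_bigr => p _; rewrite !BA !eqxx /=; field.
    by rewrite !big_split /= !sum_delta ji /=; ring.
  have E2 : 4 * (m * dot (B i j) (B i j)) = m1 i ^+ 2 + m1 j ^+ 2.
    rewrite conformal_parseval mulr_sumr.
    transitivity (\sum_p ((i == p)%:R * (m1 j ^+ 2 * (i == p)%:R + 2 * m1 i * m1 j * (j == p)%:R)
      + (j == p)%:R * (m1 i ^+ 2 * (j == p)%:R))).
      by apply: eq_bigr => p _; rewrite !BA ij /=; field.
    by rewrite big_split /= !sum_delta !eqxx ji /=; ring.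
  have : m * (2 * dot (B i i) (B j j) - 2 * dot (B i j) (B i j)) =
      m * (- m2 j j - m2 i i) by rewrite E; ring.
  lra.
have [<-|lq] := eqVneq l q.
  (* Three distinct indices whose defects have pairwise sums 0: each defect is 0. This takes a
     dimension greater than 2. *)
  have [j [lj _]] := ord_ne2 l l; have [k [lk jk]] := ord_ne2 l j.
  by have := pair _ _ lj; have := pair _ _ lk; have := pair _ _ jk;
  move=> /=; lra.
(* Flatness at [i, i, l, q], with [i] distinct from both [l] and [q], has only [- m2 l q] on its
   right side. *)
have [i [/negPf li /negPf qi]] := ord_ne2 l q.
have {}lq := negPf lq.
have il : (i == l) = false by rewrite eq_sym.
have iq : (i == q) = false by rewrite eq_sym.
have := conformal_flat i i l q; rewrite il iq lq eqxx /= => E.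
have E1 : 4 * (m * dot (B i i) (B l q)) = - 2 * m1 l * m1 q.
  rewrite conformal_parseval mulr_sumr.
  transitivity (\sum_p ((i == p)%:R * (2 * m1 i * m1 q * (l == p)%:R + 2 * m1 i * m1 l * (q == p)%:R)
      + ((l == p)%:R * (- m1 q * m1 p) + (q == p)%:R * (- m1 l * m1 p)))).
    by apply: eq_bigr => p _; rewrite !BA lq eqxx /=; field.
  by rewrite !big_split /= !sum_delta li qi /=; ring.
have E2 : 4 * (m * dot (B i l) (B i q)) = m1 l * m1 q.
  rewrite conformal_parseval mulr_sumr.
  transitivity (\sum_p ((i == p)%:R * (m1 l * m1 q * (i == p)%:R + m1 l * m1 i * (q == p)%:R)
      + (l == p)%:R * (m1 i * (m1 q * (i == p)%:R + m1 i * (q == p)%:R)))).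
    by apply: eq_bigr => p _; rewrite !BA il iq /=; field.
  by rewrite big_split /= !sum_delta !eqxx qi il [q == l]eq_sym lq /=; ring.
have : m * (2 * dot (B i i) (B l q) - 2 * dot (B i l) (B i q)) = m * - m2 l q.
  by rewrite E; ring.
lra.
Qed.

End ConformalJet.

(** * The conformal factor along a line *)

Section RealLemmas.
Variable R : realType.

Lemma is_deriveX_fun (f : R -> R) k (x df : R) : is_derive x 1 f df ->
  is_derive x 1 (fun y => f y ^+ k.+1) (k.+1%:R * f x ^+ k * df).
Proof.
move=> /(is_deriveX k.+1); congr (is_derive _ _ _ _).
by apply/funext => y; rewrite exprfctE.
Qed.

Lemma derive_unique (f g df : R -> R) (a b : R) : a <= b ->
  (forall x, a <= x <= b -> is_derive x 1 f (df x)) ->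
  (forall x, a <= x <= b -> is_derive x 1 g (df x)) ->
  f a = g a -> f b = g b.
Proof.
move=> ab fd gd fga.
have : `|(f b - g b) - (f a - g a)| <= 0 * (b - a).
  apply: (@mvt_le R (fun x => f x - g x) (fun=> 0)) => // x xab.
    rewrite -(subrr (df x)); apply: is_deriveB; [exact: fd|exact: gd].
  by rewrite normr0.
by rewrite mul0r fga subrr subr0 normr_le0 subr_eq0 => /eqP.
Qed.

(** [T] is the infimum of the points where [f] is at most 0, and continuity puts it among them. *)
Lemma first_zero (f : R -> R) (s : R) : 0 <= s ->
  (forall t, 0 <= t <= s -> {for t, continuous f}) ->
  0 < f 0 -> f s <= 0 ->
  exists T, [/\ 0 < T <= s, f T <= 0 & forall t, 0 <= t < T -> 0 < f t].
Proof.
move=> s0 fc f0 fs.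
pose S := [set t | 0 <= t <= s /\ f t <= 0].
have Ss : S s by split; rewrite ?s0 ?lexx.
have lbS : lbound S 0 by move=> t [/andP[]].
have infS : has_inf S by split; [exists s|exists 0].
pose T := inf S.
have T0 : 0 <= T by apply: lb_le_inf => //; exists s.
have Ts : T <= s by apply: ge_inf => //; exists 0.
have fT : f T <= 0.
  rewrite leNgt; apply/negP => fT.
  have /cvgrPdist_lt /(_ _ fT) [d /= d0 fd] : {for T, continuous f}.
    by apply: fc; rewrite T0.
  have [t [tS ft] tT] := inf_adherent d0 infS.
  have Tt : T <= t by apply: ge_inf; [exists 0|].
  have /fd : `|T - t| < d.
    by rewrite distrC ger0_norm ?subr_ge0 // ltrBlDl.
  rewrite ltr_norml; lra.
exists T; split=> //.
  rewrite Ts andbT lt_neqAle T0 andbT; apply/eqP => T0'.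
  by move: fT; rewrite -T0'; lra.
move=> t /andP[t0 tT]; rewrite ltNge; apply/negP => ft.
have : T <= t by apply: ge_inf; [exists 0|split=> //; rewrite t0; lra].
lra.
Qed.

End RealLemmas.

Section LiouvilleLine.
Variables (R : realType) (d : nat).
Variables (m : R -> R) (p q : 'I_d -> R -> R) (e : 'I_d -> R) (rho : R).
Local Notation P t := (\sum_i e i * p i t).
Local Notation N t := (\sum_i p i t ^+ 2).
Hypothesis e1 : \sum_i e i ^+ 2 = 1.
Hypothesis dm : forall t : R, 0 <= t < rho -> is_derive t 1 m (P t).
Hypothesis dp : forall i (t : R), 0 <= t < rho -> is_derive t 1 (p i) (q i t).
Hypothesis mq : forall i t, 0 <= t < rho ->
  2 * m t * q i t = 3 * p i t * P t - N t / 2 * e i.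
Hypothesis m0 : 0 < m 0.
Local Notation Q t := (1 - P 0 / (2 * m 0) * t + N 0 / (16 * m 0 ^+ 2) * t ^+ 2).

(** Here [m] is the conformal factor along a line with unit direction [e], [p] its gradient and [q]
    the derivative of the gradient along the line. As long as [m] is positive, u = 1 / sqrt m has
    constant second derivative, so it equals u(0) Q, and [m] is the inverse square of [u]. *)
Lemma liouville_line_pos t : 0 <= t < rho ->
  (forall s, 0 <= s <= t -> 0 < m s) -> m t * Q t ^+ 2 = m 0.
Proof.
move=> /andP[t0 trho] mpos.
pose u s := (Num.sqrt (m s))^-1.
have dom s : 0 <= s <= t -> 0 <= s < rho.
  by move=> /andP[-> st]; exact: le_lt_trans st trho.
have u2m s : 0 <= s <= t -> u s ^+ 2 * m s = 1.
  move=> /mpos ms; rewrite /u exprVn sqr_sqrtr ?(ltW ms) //.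
  by rewrite mulVf // gt_eqF.
have u_gt0 s : 0 <= s <= t -> 0 < u s.
  by move=> /mpos ms; rewrite invr_gt0 sqrtr_gt0.
have du s : 0 <= s <= t -> is_derive s 1 u (- P s * u s ^+ 3 / 2).
  move=> st; have ms := mpos s st.
  have sm : 0 < Num.sqrt (m s) by rewrite sqrtr_gt0.
  have := is_derive1_comp (is_derive1_sqrt ms) (dm (dom s st)).
  move=> /is_deriveV; rewrite gt_eqF //= => /(_ isT).
  move=> H; apply: is_derive_eq H _.
  rewrite /u; set v := Num.sqrt _.
  change (- v ^- 2 * ((2 * v)^-1 * P s) = - P s * v^-1 ^+ 3 / 2).
  by field; rewrite gt_eqF.
have qE i s : 0 <= s <= t ->
    q i s = u s ^+ 2 * (3 * p i s * P s - N s / 2 * e i) / 2.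
  move=> st; rewrite -mq ?dom //.
  rewrite (_ : _ / 2 = (u s ^+ 2 * m s) * q i s); last by field.
  by rewrite u2m // mul1r.
have dP s : 0 <= s <= t ->
    is_derive s 1 (fun s => P s) (u s ^+ 2 * (3 * P s ^+ 2 - N s / 2) / 2).
  move=> st.
  have : is_derive s 1 (fun s => P s) (\sum_i e i * q i s).
    apply: is_derive_sum_fun => i.
    apply: is_derive_eq (is_deriveM_fun (is_derive_cst (e i) s 1) (dp i (dom s st))) _.
    by rewrite mul0r add0r.
  move=> H; apply: is_derive_eq H _.
  transitivity (\sum_i (u s ^+ 2 / 2 * 3 * P s * (e i * p i s)
    - u s ^+ 2 / 2 * (N s / 2) * e i ^+ 2)).
    by apply: eq_bigr => i _; rewrite qE //; field.
  by rewrite sumrB -!mulr_sumr e1; field.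
have dN s : 0 <= s <= t -> is_derive s 1 (fun s => N s) (5 / 2 * u s ^+ 2 * N s * P s).
  move=> st.
  have : is_derive s 1 (fun s => N s) (\sum_i 2 * p i s ^+ 1 * q i s).
    apply: is_derive_sum_fun => i.
    by apply: is_derive_eq (is_deriveX_fun 1 (dp i (dom s st))) _.
  move=> H; apply: is_derive_eq H _.
  transitivity (\sum_i (u s ^+ 2 * 3 * P s * p i s ^+ 2
    - u s ^+ 2 * (N s / 2) * (e i * p i s))).
    by apply: eq_bigr => i _; rewrite qE //; field.
  by rewrite sumrB -!mulr_sumr; field.
(* This is |grad u|^2 / (2 u), since grad u = - u^3 p / 2. *)
pose sigma s := N s * u s ^+ 5 / 8.
have sigmaE s : 0 <= s <= t -> sigma s = sigma 0.
  move=> /andP[s0 st].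
  apply: (@derive_unique R sigma (fun=> sigma 0) (fun=> 0) 0 s) => // x /andP[x0 xs].
    have xt : 0 <= x <= t by rewrite x0 (le_trans xs).
    have := is_deriveM_fun (is_deriveM_fun (dN x xt) (is_deriveX_fun 4 (du x xt)))
      (is_derive_cst (8^-1 : R) x 1).
    by move=> H; apply: is_derive_eq H _; field.
(* [W] is the derivative of [u], and its own derivative is the constant [sigma]. *)
pose W s := - P s * u s ^+ 3 / 2.
have WE s : 0 <= s <= t -> W s = W 0 + sigma 0 * s.
  move=> /andP[s0 st].
  apply: (@derive_unique R W (fun x => W 0 + sigma 0 * x) (fun=> sigma 0) 0 s) => //.
  - move=> x /andP[x0 xs].
    have xt : 0 <= x <= t by rewrite x0 (le_trans xs).
    have := is_deriveM_fun (is_deriveM_fun (is_deriveM_fun (is_derive_cst (-1 : R) x 1) (dP x xt))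
      (is_deriveX_fun 2 (du x xt))) (is_derive_cst (2^-1 : R) x 1).
    rewrite (_ : (fun _ => _) = W); last first.
      by apply/funext => y; rewrite /W /= mulN1r.
    by move=> H; apply: is_derive_eq H _; rewrite -(sigmaE x) // /sigma /=; field.
  - move=> x _.
    have := is_deriveD_fun (is_derive_cst (W 0) x 1)
      (is_deriveM_fun (is_derive_cst (sigma 0) x 1) (is_derive_id x 1)).
    by move=> H; apply: is_derive_eq H _; rewrite /=; ring.
  - by rewrite mulr0 addr0.
have uE : u t = u 0 + W 0 * t + sigma 0 * t ^+ 2 / 2.
  apply: (@derive_unique R u (fun x => u 0 + W 0 * x + sigma 0 * x ^+ 2 / 2)
    (fun x => W 0 + sigma 0 * x) 0 t) => //.
  - by move=> x xt; rewrite -WE //; exact: du.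
  - move=> x _.
    have := is_deriveD_fun (is_deriveD_fun (is_derive_cst (u 0) x 1)
      (is_deriveM_fun (is_derive_cst (W 0) x 1) (is_derive_id x 1)))
      (is_deriveM_fun (is_deriveM_fun (is_derive_cst (sigma 0) x 1)
         (is_deriveX_fun 1 (is_derive_id x 1))) (is_derive_cst (2^-1 : R) x 1)).
    by move=> H; apply: is_derive_eq H _; rewrite /=; field.
  - by rewrite expr0n /= !mulr0 mul0r !addr0.
have z0 : 0 <= (0 : R) <= t by rewrite lexx t0.
have tt : 0 <= t <= t by rewrite t0 lexx.
have m0E : m 0 = u 0 ^- 2.
  have := u2m 0 z0; move=> /(canRL (mulKf _)); rewrite mulr1; apply.
  by rewrite expf_neq0 // gt_eqF ?u_gt0.
have {}uE : u t = u 0 * Q t.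
  rewrite uE /W /sigma m0E; field.
  by rewrite gt_eqF ?u_gt0.
have u0_neq0 : u 0 ^+ 2 != 0 by rewrite expf_neq0 // gt_eqF ?u_gt0.
apply: (mulfI u0_neq0); rewrite [X in _ = _ * X]m0E mulfV //.
by rewrite -[RHS](u2m t tt) uE; ring.
Qed.

Hypothesis m_ge0 : forall t, 0 <= t < rho -> 0 <= m t.

(** Before a first zero of [m] the product m Q^2 is the positive constant [m 0], while by continuity
    it tends to 0 there; so there is no zero, and positivity holds on the whole interval. *)
Lemma liouville_line t : 0 <= t < rho -> 0 < m t /\ m t * Q t ^+ 2 = m 0.
Proof.
have mc s : 0 <= s < rho -> {for s, continuous m}.
  move=> srho; apply/differentiable_continuous/derivable1_diffP.
  exact: (@ex_derive _ _ _ _ _ _ _ (dm srho)).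
have mpos s : 0 <= s < rho -> 0 < m s.
  move=> /andP[s0 srho]; rewrite ltNge; apply/negP => ms.
  have [|T [/andP[T0 Ts] mT mpos]] := first_zero s0 _ m0 ms.
    by move=> x /andP[x0 xs]; apply: mc; rewrite x0 (le_lt_trans xs).
  have Trho : 0 <= T < rho by rewrite (ltW T0) (le_lt_trans Ts).
  have {}mT : m T = 0 by apply: le_anti; rewrite mT m_ge0.
  have Qc : {for T, continuous (fun t => m t * Q t ^+ 2)}.
    apply/differentiable_continuous/derivable1_diffP.
    pose dQ t := - (P 0 / (2 * m 0)) + N 0 / (16 * m 0 ^+ 2) * (2 * t).
    have QD : is_derive T 1 (fun t => Q t) (dQ T).
      have := is_deriveD_fun (is_deriveD_fun (is_derive_cst (1 : R) T 1)
        (is_deriveM_fun (is_derive_cst (- (P 0 / (2 * m 0))) T 1) (is_derive_id T 1)))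
        (is_deriveM_fun (is_derive_cst (N 0 / (16 * m 0 ^+ 2)) T 1)
           (is_deriveX_fun 1 (is_derive_id T 1))).
      rewrite (_ : (fun _ => _) = fun t => Q t); last first.
        by apply/funext => y /=; rewrite mulNr.
      by move=> H; apply: is_derive_eq H _; rewrite /dQ /=; ring.
    exact: (@ex_derive _ _ _ _ _ _ _ (is_deriveM_fun (dm Trho) (is_deriveX_fun 1 QD))).
  have /cvgrPdist_lt/(_ _ m0)[c /= c0 Tc] := Qc.
  (* A point of [0, T) within [c] of [T]: there m Q^2 is below [m 0] by continuity and equal to it
     by [liouville_line_pos]. *)
  pose t' := Order.max (T / 2) (T - c / 2).
  have t'T : 0 <= t' < T.
    by rewrite /t' le_max gt_max; apply/andP; split; [apply/orP; left; lra|apply/andP; split; lra].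
  have := Tc t'; rewrite mT mul0r sub0r normrN => /(_ _).
  rewrite liouville_line_pos.
  - rewrite gtr0_norm // ltxx => H; suff : false by []; apply: H.
    rewrite /ball_ /= ger0_norm; last by case/andP: t'T => _ /ltW; rewrite subr_ge0.
    have : T - c / 2 <= t' by rewrite /t' le_max lexx orbT.
    lra.
  - case/andP: t'T => -> /lt_trans; apply; by case/andP: Trho.
  - move=> s' /andP[s'0 s't]; apply: mpos; rewrite s'0.
    by case/andP: t'T => _; exact: le_lt_trans.
move=> trho; split; first exact: mpos.
apply: liouville_line_pos => // s /andP[s0 st]; apply: mpos; rewrite s0.
by case/andP: trho => _; exact: le_lt_trans.
Qed.

End LiouvilleLine.

(** * Derivative bounds for conformal maps *)

Section DotSums.
Variables (R : realType) (d : nat).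

Lemma dot_suml (I : Type) (s : seq I) (c : I -> R) (F : I -> 'rV[R]_d) v :
  dot (\sum_(i <- s) c i *: F i) v = \sum_(i <- s) c i * dot (F i) v.
Proof.
elim: s => [|i s IHs].
  by rewrite !big_nil /dot big1 // => k _; rewrite mxE mul0r.
rewrite !big_cons dotDl IHs; congr (_ + _).
by rewrite /dot mulr_sumr; apply: eq_bigr => k _; rewrite mxE mulrA.
Qed.

Lemma is_derive_dot (E : normedModType R) (G H : 'I_d -> E -> R) y v :
  (forall a, derivable (G a) y v) -> (forall a, derivable (H a) y v) ->
  is_derive y v (fun z => dot (\row_a G a z) (\row_a H a z))
    (dot (\row_a 'D_v (G a) y) (\row_a H a y) +
     dot (\row_a G a y) (\row_a 'D_v (H a) y)).
Proof.
move=> dG dH; rewrite /dot -big_split /=.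
under eq_fun do under eq_bigr do rewrite !mxE.
apply: is_derive_sum_fun => a; rewrite !mxE.
by apply: is_deriveM_fun; apply: derivableP.
Qed.

Lemma is_derive_near (E : normedModType R) (f g : E -> R) (U : set E) y v df dg :
  open U -> U y -> (forall z, U z -> f z = g z) ->
  is_derive y v f df -> is_derive y v g dg -> df = dg.
Proof.
move=> oU Uy fg [_ <-] [_ <-]; apply: near_eq_derive.
by near=> z; apply: fg; near: z; exact: open_nbhs_nbhs.
Unshelve. all: by end_near. Qed.

End DotSums.

Section ConformalSlices.
Variables (R : realType) (r n : nat).
Hypothesis r_le3 : (r <= 3)%N.
Local Notation d := (cd_dim r).
Hypothesis d_ge3 : (2 < d)%N.
Local Notation E := 'M[R]_(n, d).
Variables (U : set E) (f : E -> 'rV[R]_d) (j : 'I_n).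
Hypothesis U_open : open U.

(* The increment [e] of the variable _jz. *)
Definition emb (e : 'rV[R]_d) : E := delta_mx j 0 *m e.
Local Notation b i := (emb (delta_mx 0 i)).

Definition d1 i a : E -> R := 'D_(b i) (fun z => f z ord0 a).
Definition d2 i k a : E -> R := 'D_(b k) (d1 i a).
Definition d3 i k l a : E -> R := 'D_(b l) (d2 i k a).
Definition V1 i x : 'rV[R]_d := \row_a d1 i a x.
Definition V2 i k x : 'rV[R]_d := \row_a d2 i k a x.
Definition V3 i k l x : 'rV[R]_d := \row_a d3 i k l a x.

Let i0 : 'I_d := Ordinal d_ge3.
(* The squared conformal factor, written with one column of the Jacobian, and
   its first and second derivatives. *)
Definition mu x := dot (V1 i0 x) (V1 i0 x).
Definition mu1 l x := dot (V2 i0 l x) (V1 i0 x) + dot (V1 i0 x) (V2 i0 l x).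
Definition mu2 l q x :=
  dot (V3 i0 l q x) (V1 i0 x) + dot (V2 i0 l x) (V2 i0 q x) +
  (dot (V2 i0 q x) (V2 i0 l x) + dot (V1 i0 x) (V3 i0 l q x)).

Hypothesis f_an : forall x, U x -> forall a, analytic_at (fun z => f z ord0 a) x.
Hypothesis f_conf : forall x, U x -> forall i k,
  dot (V1 i x) (V1 k x) = mu x * (i == k)%:R.

Lemma d1_an x i a : U x -> analytic_at (d1 i a) x.
Proof. by move=> Ux; apply: analytic_at_deriv => //; exact: f_an. Qed.

Lemma d2_an x i k a : U x -> analytic_at (d2 i k a) x.
Proof. by move=> Ux; apply: analytic_at_deriv => //; exact: d1_an. Qed.

Lemma emb_sum e : emb e = \sum_i e ord0 i *: b i.
Proof.
rewrite {1}[e]row_sum_delta /emb mulmx_sumr.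
by apply: eq_bigr => i _; rewrite -scalemxAr.
Qed.

Lemma derive_emb g x e : analytic_at g x ->
  'D_(emb e) g x = \sum_i e ord0 i * 'D_(b i) g x.
Proof.
move=> ga; rewrite emb_sum; elim: (index_enum _) => [|i s IHs].
  by rewrite !big_nil derive0.
by rewrite !big_cons (analytic_at_derivP _ _ _ _ ga) ?IHs.
Qed.

Lemma is_derive_V11 x v i k : U x ->
  is_derive x v (fun z => dot (V1 i z) (V1 k z))
    (dot (\row_a 'D_v (d1 i a) x) (V1 k x) + dot (V1 i x) (\row_a 'D_v (d1 k a) x)).
Proof.
by move=> Ux; apply: is_derive_dot => a; apply: analytic_at_derivable => //; exact: d1_an.
Qed.

Lemma is_derive_V21 x v i l k : U x ->
  is_derive x v (fun z => dot (V2 i l z) (V1 k z))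
    (dot (\row_a 'D_v (d2 i l a) x) (V1 k x) + dot (V2 i l x) (\row_a 'D_v (d1 k a) x)).
Proof.
by move=> Ux; apply: is_derive_dot => a; apply: analytic_at_derivable => //;
  [exact: d2_an|exact: d1_an].
Qed.

Lemma is_derive_V12 x v i l k : U x ->
  is_derive x v (fun z => dot (V1 i z) (V2 k l z))
    (dot (\row_a 'D_v (d1 i a) x) (V2 k l x) + dot (V1 i x) (\row_a 'D_v (d2 k l a) x)).
Proof.
by move=> Ux; apply: is_derive_dot => a; apply: analytic_at_derivable => //;
  [exact: d1_an|exact: d2_an].
Qed.

(** The relations [f_conf] hold on an open set, so they may be differentiated; [conf2] repeats
    this. *)
Lemma conf1 x : U x -> forall i k l,
  dot (V2 i l x) (V1 k x) + dot (V1 i x) (V2 k l x) = mu1 l x * (i == k)%:R.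
Proof.
move=> Ux i k l.
apply: (is_derive_near U_open Ux _ (is_derive_V11 (b l) i k Ux)) => [z Uz|].
  exact: f_conf.
have := is_deriveM_fun (is_derive_V11 (b l) i0 i0 Ux) (is_derive_cst ((i == k)%:R : R) x (b l)).
by move=> H; apply: is_derive_eq H _; rewrite mulr0 addr0.
Qed.

Lemma conf2 x : U x -> forall i k l q,
  dot (V3 i l q x) (V1 k x) + dot (V2 i l x) (V2 k q x) +
  (dot (V2 i q x) (V2 k l x) + dot (V1 i x) (V3 k l q x)) = mu2 l q x * (i == k)%:R.
Proof.
move=> Ux i k l q.
have der i' k' := is_deriveD_fun (is_derive_V21 (b q) i' l k' Ux)
  (is_derive_V12 (b q) i' l k' Ux).
apply: (is_derive_near U_open Ux _ (der i k)) => [z Uz|].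
  exact: conf1.
have := is_deriveM_fun (der i0 i0) (is_derive_cst ((i == k)%:R : R) x (b q)).
by move=> H; apply: is_derive_eq H _; rewrite mulr0 addr0.
Qed.

Lemma V2C x i k : U x -> V2 i k x = V2 k i x.
Proof.
move=> Ux; apply/rowP => a; rewrite [LHS]mxE [RHS]mxE.
exact: (analytic_at_derivC r_le3 _ _ (f_an Ux a)).
Qed.

Lemma V3C2 x i k l : U x -> V3 i k l x = V3 i l k x.
Proof.
move=> Ux; apply/rowP => a; rewrite [LHS]mxE [RHS]mxE.
exact: (analytic_at_derivC r_le3 _ _ (d1_an i a Ux)).
Qed.

Lemma V3C1 x i k l : U x -> V3 i k l x = V3 k i l x.
Proof.
move=> Ux; apply/rowP => a; rewrite [LHS]mxE [RHS]mxE; apply: near_eq_derive.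
near=> z; have Uz : U z by near: z; exact: open_nbhs_nbhs.
by have := congr1 (fun v : 'rV_d => v ord0 a) (V2C i k Uz); rewrite [LHS]mxE [RHS]mxE.
Unshelve. all: by end_near. Qed.

Local Notation N x := (\sum_p mu1 p x ^+ 2).

Lemma hessian_mu x l q : U x ->
  2 * mu x * mu2 l q x = 3 * mu1 l x * mu1 q x - N x / 2 * (l == q)%:R.
Proof.
move=> Ux; apply: (conformal_hessian d_ge3 (f_conf Ux) (conf1 Ux) _ (conf2 Ux)).
- by move=> i k; exact: V2C.
- by move=> i k s; exact: V3C1.
- by move=> i k s; exact: V3C2.
Qed.

Lemma second_norm_mu x i : U x -> 4 * mu x * dot (V2 i i x) (V2 i i x) = N x.
Proof.
move=> Ux; apply: (conformal_second_norm (f_conf Ux) (conf1 Ux)).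
by move=> k l; exact: V2C.
Qed.

Lemma row_derive_emb x e (G : 'I_d -> E -> R) : (forall a, analytic_at (G a) x) ->
  \row_a 'D_(emb e) (G a) x = \sum_l e ord0 l *: \row_a 'D_(b l) (G a) x.
Proof.
move=> Ga; apply/rowP => a; rewrite summxE [LHS]mxE derive_emb //.
by apply: eq_bigr => l _; rewrite [RHS]mxE; congr (_ * _); rewrite mxE.
Qed.

Lemma row_d1_emb x e i : U x ->
  \row_a 'D_(emb e) (d1 i a) x = \sum_l e ord0 l *: V2 i l x.
Proof. by move=> Ux; exact: (row_derive_emb e (fun a => d1_an i a Ux)). Qed.

Lemma row_d2_emb x e i k : U x ->
  \row_a 'D_(emb e) (d2 i k a) x = \sum_l e ord0 l *: V3 i k l x.
Proof. by move=> Ux; exact: (row_derive_emb e (fun a => d2_an i k a Ux)). Qed.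

Lemma dot_sumr (e v : 'rV[R]_d) (F : 'I_d -> 'rV[R]_d) :
  dot v (\sum_l e ord0 l *: F l) = \sum_l e ord0 l * dot v (F l).
Proof. by rewrite dotC dot_suml; apply: eq_bigr => l _; rewrite dotC. Qed.

Lemma dot_sum4 (e v w : 'rV[R]_d) (F G : 'I_d -> 'rV[R]_d) :
  dot (\sum_l e ord0 l *: F l) v + dot w (\sum_l e ord0 l *: G l) +
  (dot (\sum_l e ord0 l *: G l) w + dot v (\sum_l e ord0 l *: F l)) =
  \sum_l e ord0 l * (dot (F l) v + dot w (G l) + (dot (G l) w + dot v (F l))).
Proof.
rewrite !dot_suml !dot_sumr -!big_split /=.
by apply: eq_bigr => q _; rewrite -!mulrDr.
Qed.

Lemma is_derive_mu x e : U x ->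
  is_derive x (emb e) mu (\sum_l e ord0 l * mu1 l x).
Proof.
move=> Ux; apply: is_derive_eq (is_derive_V11 (emb e) i0 i0 Ux) _.
rewrite (row_d1_emb e i0 Ux) dot_suml dot_sumr -big_split /=.
by apply: eq_bigr => l _; rewrite -mulrDr.
Qed.

Lemma is_derive_mu1 x e l : U x ->
  is_derive x (emb e) (mu1 l) (\sum_q e ord0 q * mu2 l q x).
Proof.
move=> Ux; apply: is_derive_eq (is_deriveD_fun (is_derive_V21 (emb e) i0 l i0 Ux)
  (is_derive_V12 (emb e) i0 l i0 Ux)) _.
transitivity (dot (\sum_q e ord0 q *: V3 i0 l q x) (V1 i0 x) +
   dot (V2 i0 l x) (\sum_q e ord0 q *: V2 i0 q x) +
  (dot (\sum_q e ord0 q *: V2 i0 q x) (V2 i0 l x) +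
   dot (V1 i0 x) (\sum_q e ord0 q *: V3 i0 l q x))).
  have E1 := row_d1_emb e i0 Ux; have E2 := row_d2_emb e i0 l Ux.
  apply: congr2; apply: congr2.
  - exact: (congr1 (fun v => dot v _) E2).
  - exact: (congr1 (fun v => dot _ v) E1).
  - exact: (congr1 (fun v => dot v _) E1).
  - exact: (congr1 (fun v => dot _ v) E2).
exact: dot_sum4.
Qed.

Lemma embP a e e' : emb (a *: e + e') = a *: emb e + emb e'.
Proof. by rewrite /emb mulmxDr -scalemxAr. Qed.

Lemma embZ a e : emb (a *: e) = a *: emb e.
Proof. by rewrite /emb -scalemxAr. Qed.

Lemma mu_ge0 x : 0 <= mu x.
Proof. by rewrite /mu -enorm_sqr sqr_ge0. Qed.

Lemma mu_line x e rho : (forall t, 0 <= t < rho -> U (x + t *: emb e)) ->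
  dot e e = 1 -> 0 < mu x -> forall t, 0 <= t < rho ->
  0 < mu (x + t *: emb e) /\
  mu (x + t *: emb e) * (1 - (\sum_l e ord0 l * mu1 l x) / (2 * mu x) * t
    + N x / (16 * mu x ^+ 2) * t ^+ 2) ^+ 2 = mu x.
Proof.
move=> Ux e1 mux t trho.
have x0 : x + 0 *: emb e = x by rewrite scale0r addr0.
have := @liouville_line R d (fun t => mu (x + t *: emb e))
  (fun i t => mu1 i (x + t *: emb e))
  (fun i t => \sum_q e ord0 q * mu2 i q (x + t *: emb e)) (fun i => e ord0 i) rho.
rewrite x0; apply=> //.
- by move=> s srho; apply: is_derive_line; apply: is_derive_mu; exact: Ux.
- by move=> i s srho; apply: is_derive_line; apply: is_derive_mu1; exact: Ux.
- move=> i s srho; rewrite mulr_sumr.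
  transitivity (\sum_q (3 * mu1 i (x + s *: emb e) * (e ord0 q * mu1 q (x + s *: emb e))
    - (i == q)%:R * (N (x + s *: emb e) / 2 * e ord0 q))).
    apply: eq_bigr => q _; rewrite mulrCA.
    have := congr1 ( *%R (e ord0 q)) (hessian_mu i q (Ux s srho)).
    move: (mu _) (mu1 _ _) (mu1 _ _) (mu2 _ _ _) (\sum_p _) => w w1 w2 w3 w4 ->.
    ring.
  by rewrite sumrB -mulr_sumr sum_delta.
- by move=> s _; exact: mu_ge0.
Qed.

Definition box x rho := forall e, enorm e < rho -> U (x + emb e).

Lemma box_line x rho e t : box x rho -> dot e e = 1 -> 0 <= t < rho ->
  U (x + t *: emb e).
Proof.
move=> xrho e1 /andP[t0 trho]; rewrite -embZ; apply: xrho.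
have ee : enorm e = 1.
  by apply/eqP; rewrite -(@eqrXn2 _ 2) ?enorm_ge0 // enorm_sqr e1 expr1n.
by rewrite enormZ ee mulr1 ger0_norm.
Qed.

Lemma box_shift x rho e : box x rho -> enorm e <= rho / 2 -> box (x + emb e) (rho / 2).
Proof.
move=> xrho erho e' e'rho; rewrite -addrA -(_ : emb (e + e') = emb e + emb e').
  apply: xrho; apply: le_lt_trans (ler_enormD _ _) _; lra.
by have := embP 1 e e'; rewrite !scale1r.
Qed.

Lemma box_center x rho : 0 < rho -> box x rho -> U x.
Proof.
by move=> rho0 /(_ 0); rewrite enorm0 /emb mulmx0 addr0 => /(_ rho0).
Qed.

(** In the direction of the gradient, of norm g, the polynomial of [mu_line] is the square of 1 - g
    t / (4 mu). Its zero t = 4 mu / g contradicts [mu_line] if it is less than [rho]. *)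
Lemma gradient_bound x rho : 0 < rho -> box x rho -> 0 < mu x ->
  N x * rho ^+ 2 <= 16 * mu x ^+ 2.
Proof.
move=> rho0 xrho mux.
have N0 : 0 <= N x by apply: sumr_ge0 => p _; rewrite sqr_ge0.
have [NE|Nneq0] := eqVneq (N x) 0; first by rewrite NE mul0r mulr_ge0 ?sqr_ge0.
pose g := Num.sqrt (N x).
have g0 : 0 < g by rewrite sqrtr_gt0 lt0r Nneq0.
have g2 : g ^+ 2 = N x by rewrite sqr_sqrtr.
pose e : 'rV[R]_d := \row_l (mu1 l x / g).
have e1 : dot e e = 1.
  transitivity (g ^- 2 * N x); last by rewrite -g2 mulVf // expf_neq0 // gt_eqF.
  rewrite mulr_sumr; apply: eq_bigr => l _; rewrite !mxE; field; by rewrite gt_eqF.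
have Pg : \sum_l e ord0 l * mu1 l x = g.
  transitivity (g^-1 * N x); last by rewrite -g2; field; rewrite gt_eqF.
  rewrite mulr_sumr; apply: eq_bigr => l _; rewrite !mxE; field; by rewrite gt_eqF.
rewrite leNgt; apply/negP => H.
have gr : 4 * mu x / g < rho.
  rewrite ltr_pdivrMr // -ltr_sqr ?nnegrE ?mulr_ge0 ?(ltW mux) ?(ltW rho0) ?(ltW g0) //.
  by rewrite !exprMn g2; lra.
have trho : 0 <= 4 * mu x / g < rho by rewrite gr andbT divr_ge0 ?mulr_ge0 ?(ltW mux) ?(ltW g0).
have [_] := mu_line (fun t => @box_line x rho e t xrho e1) e1 mux trho.
rewrite Pg -g2 (_ : 1 - _ + _ = 0); last by field; rewrite !gt_eqF.
by rewrite expr0n mulr0 => E; move: mux; rewrite -E ltxx.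
Qed.

Lemma mu_gt0_box x rho e : box x rho -> 0 < mu x -> enorm e < rho ->
  0 < mu (x + emb e).
Proof.
move=> xrho mux erho.
have [->|e0] := eqVneq e 0; first by rewrite /emb mulmx0 addr0.
have ee0 : 0 < enorm e.
  by rewrite lt0r enorm_ge0 andbT; apply: contraNneq e0 => /enorm_eq0 ->.
pose e' := (enorm e)^-1 *: e.
have e'1 : dot e' e' = 1.
  by rewrite -enorm_sqr enormZ ger0_norm ?invr_ge0 ?enorm_ge0 // mulVf ?expr1n // gt_eqF.
have erho' : 0 <= enorm e < rho by rewrite (ltW ee0).
have [+ _] := mu_line (fun t => @box_line x rho e' t xrho e'1) e'1 mux erho'.
by rewrite -embZ scalerA mulfV ?scale1r // gt_eqF.
Qed.

(** By [gradient_bound] and Cauchy-Schwarz the directional derivative P satisfies P rho <= 4 mu. So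
    P t <= mu for t <= rho / 4, which gives Q >= 1/2 and mu / Q^2 <= 4 mu. *)
Lemma mu_le4 x rho e t : 0 < rho -> box x rho -> 0 < mu x -> dot e e = 1 ->
  0 <= t <= rho / 4 -> mu (x + t *: emb e) <= 4 * mu x.
Proof.
move=> rho0 xrho mux e1 /andP[t0 trho].
have trho' : 0 <= t < rho by rewrite t0; lra.
have [mt] := mu_line (fun t => @box_line x rho e t xrho e1) e1 mux trho'.
set P := \sum_l _; set Q := (1 - _ + _) => E.
have N0 : 0 <= N x by apply: sumr_ge0 => p _; rewrite sqr_ge0.
have PN : P ^+ 2 <= N x.
  pose v := \row_l mu1 l x.
  have vN : enorm v ^+ 2 = N x.
    by rewrite enorm_sqr; apply: eq_bigr => l _; rewrite !mxE.
  have PE : P = dot e v by apply: eq_bigr => l _; rewrite mxE.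
  have ee : enorm e = 1.
    by apply/eqP; rewrite -(@eqrXn2 _ 2) ?enorm_ge0 // enorm_sqr e1 expr1n.
  have := dot_le_enorm e v; have := dot_le_enorm e (- v).
  rewrite dotNr enormN ee mul1r -PE -vN; have := enorm_ge0 v; nra.
have Prho : P * rho <= 4 * mu x.
  rewrite leNgt; apply/negP => H.
  have := gradient_bound rho0 xrho mux; apply/negP; rewrite -ltNge.
  apply: (@lt_le_trans _ _ (P ^+ 2 * rho ^+ 2)); last by rewrite ler_wpM2r ?sqr_ge0.
  rewrite -exprMn (_ : 16 * _ = (4 * mu x) ^+ 2); last by ring.
  have mux4 : 0 <= 4 * mu x by rewrite mulr_ge0 // ltW.
  by rewrite ltr_sqr // nnegrE // (le_trans mux4) // ltW.
have Q2 : 1 / 2 <= Q.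
  have : P / (2 * mu x) * t <= 1 / 2.
    rewrite mulrAC ler_pdivrMr ?mulr_gt0 //.
    have : P * t <= mu x; last by lra.
    have [P0|P0] := leP 0 P; last by nra.
    have : P * t <= P * (rho / 4) by rewrite ler_wpM2l.
    lra.
  have : 0 <= N x / (16 * mu x ^+ 2) * t ^+ 2.
    by rewrite mulr_ge0 ?sqr_ge0 // divr_ge0 // mulr_ge0 ?sqr_ge0.
  rewrite /Q; lra.
have : 1 / 4 <= Q ^+ 2 by nra.
rewrite -E; nra.
Qed.

(** If [mu x] is positive, this is [gradient_bound] rewritten by [second_norm_mu]. If [mu x] is 0,
    then [mu] vanishes at nearby points of the line, since positivity at one of them would propagate
    back to [x]; so the first derivatives vanish along the line, and with them the second. *)
Lemma second_bound x rho i : 0 < rho -> box x rho ->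
  rho ^+ 2 * dot (V2 i i x) (V2 i i x) <= 4 * mu x.
Proof.
move=> rho0 xrho; have Ux := box_center rho0 xrho.
have [mux|mux] := ltP 0 (mu x).
  have := gradient_bound rho0 xrho mux; rewrite -(second_norm_mu i Ux).
  rewrite -(ler_pM2l (x := 4 * mu x)) ?mulr_gt0 //; nra.
have {}mux : mu x = 0 by apply: le_anti; rewrite mux mu_ge0.
rewrite mux mulr0 (_ : V2 i i x = 0); last first.
  apply/rowP => a; rewrite [RHS]mxE [LHS]mxE.
  have d2E : is_derive (0 : R) 1 (fun t => d1 i a (x + t *: b i)) (d2 i i a x).
    apply: is_derive_line; rewrite scale0r addr0; apply: derivableP.
    by apply: analytic_at_derivable => //; exact: d1_an.
  have d2E0 : is_derive (0 : R) 1 (cst 0 : R -> R) (d2 i i a x).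
    apply: near_eq_is_derive d2E; near=> t.
    have trho : `|t| < rho / 2.
      near: t; apply: (@nbhs0_lt _ R^o); lra.
    have te : enorm (t *: delta_mx 0 i : 'rV[R]_d) = `|t|.
      by rewrite enormZ enorm_delta mulr1.
    have tU : box (x + emb (t *: delta_mx 0 i)) (rho / 2).
      by apply: box_shift => //; rewrite te ltW.
    have mut : mu (x + t *: b i) = 0.
      apply: le_anti; rewrite mu_ge0 andbT leNgt; apply/negP; rewrite -embZ => mut.
      have := mu_gt0_box (e := - (t *: delta_mx 0 i)) tU mut.
      rewrite enormN te => /(_ trho).
      by rewrite /emb mulmxN addrK mux ltxx.
    have Ut : U (x + t *: b i) by rewrite -embZ; apply: box_center tU; lra.
    have : V1 i (x + t *: b i) = 0.
      apply: enorm_eq0; apply/eqP; rewrite -sqrf_eq0 enorm_sqr (f_conf Ut).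
      by rewrite mut mul0r.
    by move/rowP => /(_ a); rewrite [LHS]mxE [RHS]mxE.
  by case: d2E0 => _ <-; case: (is_derive_cst (0 : R) (0 : R) 1).
by rewrite {1}/dot big1 ?mulr0 // => k _; rewrite mxE mul0r.
Unshelve. all: by end_near. Qed.

Lemma normr_dot_le (v w : 'rV[R]_d) : `|dot v w| <= enorm v * enorm w.
Proof.
by rewrite ler_norml dot_le_enorm andbT lerNl -dotNr -(enormN w) dot_le_enorm.
Qed.

(** With s = sqrt(mu x), the inner product of [f] with [v], a column of the Jacobian at [x], has
    derivative s^2 at [x]. On a segment of length [tau] this derivative stays above s^2 / 2, so the
    product grows by at least s^2 tau / 2; but it is bounded by c s at both ends. *)
Lemma mu_bound (x : E) (rho c : R) : 0 < rho -> box x rho ->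
  (forall z, U z -> enorm (f z) <= c) -> rho ^+ 2 * mu x <= (64 * c) ^+ 2.
Proof.
move=> rho0 xrho fc; have Ux := box_center rho0 xrho.
have [mux|mux] := ltP 0 (mu x); last first.
  by apply: le_trans (sqr_ge0 _); rewrite mulr_ge0_le0 ?sqr_ge0.
have delta1 : dot (delta_mx 0 i0 : 'rV[R]_d) (delta_mx 0 i0) = 1.
  by rewrite -enorm_sqr enorm_delta expr1n.
pose s := Num.sqrt (mu x); pose v := V1 i0 x.
have s0 : 0 < s by rewrite sqrtr_gt0.
have s2 : s ^+ 2 = mu x by rewrite sqr_sqrtr ?mu_ge0.
have vs : enorm v = s.
  apply/eqP; rewrite -(@eqrXn2 _ 2) ?enorm_ge0 ?(ltW s0) //.
  by rewrite s2 enorm_sqr.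
pose y (t : R) : E := x + t *: b i0.
(* The second derivative of [f] on the segment is at most 8 s / rho, from [second_bound] at radius
   [rho / 2] and [mu_le4]; over the length [rho / 16] the derivative of the inner product then
   changes by at most s^2 / 2. *)
pose tau := rho / 16.
have tau0 : 0 < tau by rewrite divr_gt0.
have tau_rho t : 0 <= t <= tau -> 0 <= t <= rho / 4.
  by move=> /andP[-> /le_trans]; apply; rewrite /tau; lra.
have Uy t : 0 <= t <= tau -> U (y t).
  move=> /tau_rho /andP[t0 trho]; apply: (box_line xrho delta1); rewrite t0; lra.
have dphi (t : R) : 0 <= t <= tau ->
    is_derive t 1 (fun t => dot (f (y t)) v) (dot (V1 i0 (y t)) v).
  move=> tt; apply: (@is_derive_line R E (fun z => dot (f z) v)).
  apply: is_derive_sum_fun => a.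
  have := is_deriveM_fun (derivableP (analytic_at_derivable r_le3 (h := b i0) (f_an (Uy t tt) a)))
    (is_derive_cst (v ord0 a) (y t) (b i0)).
  by move=> H; apply: is_derive_eq H _; rewrite mulr0 addr0; congr (_ * _); rewrite mxE.
have ddphi (t : R) : 0 <= t <= tau ->
    is_derive t 1 (fun t => dot (V1 i0 (y t)) v) (dot (V2 i0 i0 (y t)) v).
  move=> tt; apply: (@is_derive_line R E (fun z => dot (V1 i0 z) v)).
  apply: is_derive_sum_fun => a.
  have := is_deriveM_fun (derivableP (analytic_at_derivable r_le3 (h := b i0) (d1_an i0 a (Uy t tt))))
    (is_derive_cst (v ord0 a) (y t) (b i0)).
  move=> H; apply: is_derive_eq (_ : is_derive _ _ _ _) _; last first.
    rewrite [X in X * _]mxE; apply: etrans (_ : 'D_(b i0) (d1 i0 a) (y t) * v ord0 a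
      + d1 i0 a (y t) * 0 = _) => //; by rewrite mulr0 addr0.
  move: H; congr (is_derive _ _ _ _); apply/funext => z.
  by rewrite [X in _ = X * _]mxE.
have V2s t : 0 <= t <= tau -> enorm (V2 i0 i0 (y t)) <= 8 * s / rho.
  move=> /tau_rho tt; have /andP[t0 trho] := tt.
  have yrho : box (y t) (rho / 2).
    rewrite /y -embZ; apply: box_shift => //.
    by rewrite enormZ enorm_delta mulr1 ger0_norm //; lra.
  have rho2 : 0 < rho / 2 by lra.
  have := second_bound i0 rho2 yrho; have := mu_le4 rho0 xrho mux delta1 tt.
  rewrite -enorm_sqr -s2 -/(y t) => H1 H2.
  rewrite ler_pdivlMr // -ler_sqr ?nnegrE ?mulr_ge0 ?enorm_ge0 ?(ltW rho0) ?(ltW s0) //.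
  rewrite !exprMn; lra.
have dphi0 t : 0 <= t <= tau -> `|dot (V1 i0 (y t)) v - s ^+ 2| <= s ^+ 2 / 2.
  move=> /andP[t0 ttau].
  have y0 : y 0 = x by rewrite /y scale0r addr0.
  have : `|dot (V1 i0 (y t)) v - dot (V1 i0 (y 0)) v| <= 8 * s / rho * s * (t - 0).
    apply: (@mvt_le R (fun t => dot (V1 i0 (y t)) v) (fun t => dot (V2 i0 i0 (y t)) v)) => //.
      by move=> t' /andP[t'0 t't]; apply: ddphi; rewrite t'0 (le_trans t't).
    move=> t' /andP[t'0 t't]; apply: le_trans (normr_dot_le _ _) _.
    by rewrite vs ler_wpM2r ?(ltW s0) // V2s // t'0 (le_trans t't).
  rewrite y0 -enorm_sqr vs subr0 => /le_trans; apply.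
  apply: (@le_trans _ _ (8 * s / rho * s * tau)).
    by rewrite ler_wpM2l // !mulr_ge0 ?invr_ge0 ?(ltW s0) ?(ltW rho0).
  rewrite /tau (_ : _ * _ = s ^+ 2 / 2) //; field; by rewrite gt_eqF.
have phi0 : `|dot (f (y tau)) v - dot (f (y 0)) v - s ^+ 2 * tau| <= s ^+ 2 / 2 * tau.
  have := @mvt_le R (fun t => dot (f (y t)) v - s ^+ 2 * t)
    (fun t => dot (V1 i0 (y t)) v - s ^+ 2) 0 tau (s ^+ 2 / 2) (ltW tau0) _ _.
  rewrite mulr0 !subr0 [X in `|X|]addrAC; apply=> t tt; last exact: dphi0.
  apply: is_deriveB; first exact: dphi.
  have := is_deriveM_fun (is_derive_cst (s ^+ 2 : R) t 1) (is_derive_id t 1).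
  by move=> H; apply: is_derive_eq H _; rewrite /=; ring.
have fv t : 0 <= t <= tau -> `|dot (f (y t)) v| <= c * s.
  move=> tt; apply: le_trans (normr_dot_le _ _) _.
  by rewrite vs ler_wpM2r ?(ltW s0) //; apply: fc; exact: Uy.
have := fv 0; have := fv tau; rewrite !lexx (ltW tau0) => /(_ isT) f1 /(_ isT) f2.
have main : s ^+ 2 / 2 * tau <= 2 * c * s.
  move: f1 f2 phi0; rewrite !ler_norml; lra.
have : rho * s <= 64 * c.
  rewrite -(ler_pM2r s0); move: main; rewrite /tau; lra.
move=> H; rewrite -s2 -exprMn ler_sqr ?nnegrE ?mulr_ge0 ?(ltW rho0) ?(ltW s0) //.
by rewrite (le_trans (enorm_ge0 _) (fc _ Ux)).
Qed.

Lemma conformal_derivative_bound x rho c i a : 0 < rho -> box x rho ->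
  (forall z, U z -> enorm (f z) <= c) -> rho * `|d1 i a x| <= 64 * c.
Proof.
move=> rho0 xrho fc; have Ux := box_center rho0 xrho.
have c0 : 0 <= c := le_trans (enorm_ge0 _) (fc _ Ux).
apply: (@le_trans _ _ (rho * enorm (V1 i x))).
  rewrite ler_wpM2l ?(ltW rho0) //.
  by apply: le_trans (enorm_coord_le (V1 i x) ord0 a); rewrite mxE.
rewrite -ler_sqr ?nnegrE ?mulr_ge0 ?enorm_ge0 ?(ltW rho0) //.
by rewrite exprMn enorm_sqr f_conf // eqxx mulr1; exact: mu_bound.
Qed.

(** Chains the two bounds: rho^4 |V2|^2 <= 4 rho^2 mu <= (128 c)^2. *)
Lemma conformal_second_derivative_bound x rho c i a : 0 < rho -> box x rho ->
  (forall z, U z -> enorm (f z) <= c) -> rho ^+ 2 * `|d2 i i a x| <= 128 * c.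
Proof.
move=> rho0 xrho fc; have Ux := box_center rho0 xrho.
have c0 : 0 <= c := le_trans (enorm_ge0 _) (fc _ Ux).
apply: (@le_trans _ _ (rho ^+ 2 * enorm (V2 i i x))).
  rewrite ler_wpM2l ?sqr_ge0 //.
  by apply: le_trans (enorm_coord_le (V2 i i x) ord0 a); rewrite mxE.
rewrite -ler_sqr ?nnegrE ?mulr_ge0 ?enorm_ge0 ?sqr_ge0 // ?(ltW rho0) //.
rewrite exprMn enorm_sqr.
have := second_bound i rho0 xrho; have := mu_bound rho0 xrho fc.
have : 0 <= rho ^+ 2 by exact: sqr_ge0.
nra.
Qed.

End ConformalSlices.

(** * Landau-Kolmogorov interpolation *)

Section Landau.
Variables (R : realType) (m d : nat).
Local Notation E := 'M[R]_(m, d).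
Local Notation I := ('I_m * 'I_d)%type.
Local Notation b p := (delta_mx p.1 p.2 : E).
Variables (z : E) (delta L M : R) (g : E -> R).
Hypotheses (L0 : 0 <= L) (M0 : 0 <= M).
Hypothesis g_der : forall (y : E) (p : I), `|y - z| < delta -> derivable g y (b p).
Hypothesis g_der2 : forall (y : E) (p : I), `|y - z| < delta -> derivable ('D_(b p) g) y (b p).
Hypothesis g_le : forall (y : E) (p : I), `|y - z| < delta -> `|'D_(b p) g y| <= L.
Hypothesis g_le2 : forall (y : E) (p : I), `|y - z| < delta -> `|'D_(b p) ('D_(b p) g) y| <= M.

Lemma norm_basis_le (p : I) : `|b p| <= 1.
Proof. by apply: mx_norm_le => // i j; rewrite mxE; case: (_ && _); rewrite ?normr1 ?normr0. Qed.

Lemma norm_scale_basis_le (s : R) (p : I) : `|s *: b p| <= `|s|.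
Proof. by rewrite normrZ ler_piMr // norm_basis_le. Qed.

Lemma segment_near (y : E) (t s : R) (p : I) : `|y - z| + `|t| < delta -> `|s| <= `|t| ->
  `|y + s *: b p - z| < delta.
Proof.
move=> yt st; rewrite addrAC; apply: le_lt_trans (ler_normD _ _) _.
apply: le_lt_trans yt; rewrite lerD2l; exact: le_trans (norm_scale_basis_le _ _) st.
Qed.

Lemma step_lipschitz (y : E) (t : R) (p : I) : `|y - z| + `|t| < delta ->
  `|g (y + t *: b p) - g y| <= L * `|t|.
Proof.
move=> yt.
pose f s := g (y + s *: b p).
have : `|f t - f 0| <= L * `|t|.
  apply: (@mvt_le_sym R f (fun s => 'D_(b p) g (y + s *: b p)) `|t|) => // s st.
    by apply: (@is_derive_line R E g y (b p)); apply: derivableP; apply: g_der (segment_near _ yt st).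
  exact: g_le (segment_near _ yt st).
by rewrite /f scale0r addr0.
Qed.

Lemma step_taylor (y : E) (t : R) (p : I) : `|y - z| + `|t| < delta ->
  `|g (y + t *: b p) - g y - t * 'D_(b p) g y| <= M * `|t| ^+ 2.
Proof.
move=> yt.
pose f s := 'D_(b p) g (y + s *: b p).
have f0 : f 0 = 'D_(b p) g y by rewrite /f scale0r addr0.
have D2 s : `|s| <= `|t| -> `|f s - f 0| <= M * `|t|.
  move=> st; apply: (@le_trans _ _ (M * `|s|)); last by rewrite ler_wpM2l.
  apply: (@mvt_le_sym R f (fun s => 'D_(b p) ('D_(b p) g) (y + s *: b p)) `|t| s M st) => x xt.
    by apply: (@is_derive_line R E ('D_(b p) g) y (b p)); apply: derivableP; apply: g_der2 (segment_near _ yt xt).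
  exact: g_le2 (segment_near _ yt xt).
pose G s := g (y + s *: b p) - s * f 0.
have : `|G t - G 0| <= M * `|t| * `|t|.
  apply: (@mvt_le_sym R G (fun s => f s - f 0) `|t|) => // s st.
    apply: is_deriveB.
      by apply: (@is_derive_line R E g y (b p)); apply: derivableP; apply: g_der (segment_near _ yt st).
    have := is_deriveM_fun (is_derive_id s 1) (is_derive_cst (f 0) s 1).
    by move=> H; apply: is_derive_eq H _; rewrite mulr0 addr0 mul1r.
by rewrite /G f0 scale0r addr0 mul0r subr0 -mulrA -expr2 [X in `|X|]addrAC.
Qed.

Local Notation psum h s := (\sum_(p <- s) h p.1 p.2 *: b p).

Lemma psum_le (h : E) (s : seq I) : `|psum h s| <= (size s)%:R * `|h|.
Proof.
elim: s => [|p s IHs]; first by rewrite big_nil normr0 mul0r.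
rewrite big_cons /= -natr1 mulrDl mul1r addrC; apply: le_trans (ler_normD _ _) _.
apply: lerD => //; apply: le_trans (norm_scale_basis_le _ _) _; exact: mx_coord_le.
Qed.

(** The increment is made one entry at a time, so that every step is parallel to a basis vector,
    where the bounds apply. *)
Lemma psum_lipschitz (h : E) (s : seq I) (y : E) : `|y - z| + (size s)%:R * `|h| < delta ->
  `|g (y + psum h s) - g y| <= (size s)%:R * (L * `|h|).
Proof.
elim: s => [|p s IHs] ys; first by rewrite big_nil addr0 subrr normr0 mul0r.
move: ys; rewrite big_cons /= -natr1 !mulrDl !mul1r => ys.
have hp := mx_coord_le h p.1 p.2.
have {}IHs : `|g (y + psum h s) - g y| <= (size s)%:R * (L * `|h|).
  by apply: IHs; have := normr_ge0 h; lra.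
have step : `|g (y + psum h s + h p.1 p.2 *: b p) - g (y + psum h s)| <= L * `|h|.
  apply: le_trans (step_lipschitz _ _) _; last by rewrite ler_wpM2l.
  rewrite addrAC; have := ler_normD (y - z) (psum h s).
  have := psum_le h s; lra.
rewrite [h _ _ *: _ + _]addrC addrA.
by move: IHs step; rewrite !ler_norml; lra.
Qed.

(* The Landau-Kolmogorov trick: a first derivative is a difference quotient of
   step [t] up to [M * t], so it inherits a modulus of continuity from [g]
   without any bound on mixed second derivatives. *)
Lemma psum_derive (h : E) (s : seq I) (t : R) (p : I) : 0 < t -> t + (size s)%:R * `|h| < delta ->
  `|'D_(b p) g (z + psum h s) - 'D_(b p) g z| <=
  2 * ((size s)%:R * (L * `|h|)) / t + 2 * (M * t).
Proof.
move=> t0 ts.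
have tt : `|t| = t by rewrite gtr0_norm.
have sh := psum_le h s.
have ps : `|z + psum h s - z| = `|psum h s| by rewrite addrAC subrr add0r.
have A1 : `|g (z + psum h s + t *: b p) - g (z + psum h s)
            - t * 'D_(b p) g (z + psum h s)| <= M * `|t| ^+ 2.
  by apply: step_taylor; rewrite ps tt; lra.
have A2 : `|g (z + t *: b p) - g z - t * 'D_(b p) g z| <= M * `|t| ^+ 2.
  apply: step_taylor; rewrite subrr normr0 add0r tt.
  by apply: le_lt_trans ts; rewrite lerDl mulr_ge0.
have A3 : `|g (z + psum h s) - g z| <= (size s)%:R * (L * `|h|).
  by apply: psum_lipschitz; rewrite subrr normr0 add0r; lra.
have A4 : `|g (z + t *: b p + psum h s) - g (z + t *: b p)| <= (size s)%:R * (L * `|h|).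
  apply: psum_lipschitz; rewrite addrAC subrr add0r.
  by have := norm_scale_basis_le t p; rewrite tt; lra.
move: A1 A4; rewrite [z + _ + _]addrAC => A1 A4.
rewrite -(ler_pM2l t0) -[X in X * `|_|](gtr0_norm t0) -normrM.
rewrite (_ : t * (_ / t + _) = 2 * ((size s)%:R * (L * `|h|)) + 2 * (M * t ^+ 2)); last first.
  by field; rewrite gt_eqF.
move: A1 A2 A3 A4; rewrite tt mulrBr !ler_norml.
set a1 := g _; set a2 := g _; set a3 := g _; set a4 := g _; lra.
Qed.

(** Each step is expanded at its own starting point by [step_taylor], and the derivative there is
    compared with the one at [z] by [psum_derive]. The bound [k] on all lengths keeps the error per
    step constant during the induction. *)
Lemma psum_taylor (h : E) (s : seq I) (k : nat) (t : R) : 0 < t ->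
  (size s <= k)%N -> t + k%:R * `|h| < delta ->
  `|g (z + psum h s) - g z - \sum_(p <- s) h p.1 p.2 * 'D_(b p) g z| <=
  (size s)%:R * ((2 * (k%:R * (L * `|h|)) / t + 2 * (M * t) + M * `|h|) * `|h|).
Proof.
move=> t0; elim: s => [|p s IHs] sk tk.
  by rewrite !big_nil addr0 !subrr normr0 mul0r.
rewrite !big_cons /= -natr1 mulrDl mul1r.
set K := (2 * (k%:R * (L * `|h|)) / t + 2 * (M * t) + M * `|h|) * `|h|.
have h0 := normr_ge0 h.
have sk' : (size s <= k)%N by exact: ltnW.
have skh : (size s)%:R * `|h| <= k%:R * `|h| by rewrite ler_wpM2r // ler_nat.
have hk : (size s)%:R * `|h| + `|h| <= k%:R * `|h|.
  by rewrite -[X in _ + X]mul1r -mulrDl natr1 ler_wpM2r // ler_nat.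
have {}IHs := IHs sk' tk.
have hp := mx_coord_le h p.1 p.2.
have sh := psum_le h s.
have ps : `|z + psum h s - z| = `|psum h s| by rewrite addrAC subrr add0r.
have A1 : `|g (z + psum h s + h p.1 p.2 *: b p) - g (z + psum h s)
    - h p.1 p.2 * 'D_(b p) g (z + psum h s)| <= M * `|h| ^+ 2.
  apply: le_trans (step_taylor _ _) _; first by rewrite ps; lra.
  by rewrite ler_wpM2l // lerXn2r ?nnegrE.
have A2 : `|h p.1 p.2 * ('D_(b p) g (z + psum h s) - 'D_(b p) g z)| <=
    `|h| * (2 * (k%:R * (L * `|h|)) / t + 2 * (M * t)).
  rewrite normrM; apply: ler_pM => //; apply: le_trans (psum_derive _ t0 _) _; first by lra.
  rewrite lerD2r ler_pM2r ?invr_gt0 // ler_pM2l // ler_wpM2r ?mulr_ge0 //.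
  by rewrite ler_nat.
have KE : K = `|h| * (2 * (k%:R * (L * `|h|)) / t + 2 * (M * t)) + M * `|h| ^+ 2.
  by rewrite /K; ring.
rewrite KE [h _ _ *: _ + _]addrC addrA.
move: A1 A2 IHs; rewrite !ler_norml -/K KE mulrBr.
set a1 := g _; set a2 := g _; set a3 := g _; lra.
Qed.

End Landau.

(** * Limits along an ultrafilter *)

Section UltraLimits.
Variable R : realType.

(** Compactness of [-C, C] gives a cluster point, and an ultrafilter converges to each of its
    cluster points. *)
Lemma ultra_cvg T (F : set_system T) (u : T -> R) (C : R) : UltraFilter F ->
  F [set x | `|u x| <= C] -> exists l : R, u @ F --> l.
Proof.
move=> UF FC.
have FC' : F (u @^-1` `[- C, C]%classic).
  by apply: filterS FC => x uxC /=; rewrite in_itv /= -ler_norml.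
have [l [_ lclus]] := @segment_compact R (- C) C (u @ F) _ FC'.
exists l => A lA.
have [//|FnA] := in_ultra_setVsetC (u @^-1` A) UF.
have [x [nAx Ax]] := lclus (~` A) A FnA lA.
by exfalso; exact: nAx.
Qed.

Lemma bounded_closed_compact_mx m d (V : set 'M[R]_(m, d)) :
  bounded_set V -> closed V -> compact V.
Proof.
move=> [M [_ VM]] Vcl; rewrite compact_ultra => F UF FV.
have coord i j : exists l, (fun x : 'M[R]_(m, d) => x i j) @ F --> (l : R).
  apply: (@ultra_cvg _ _ _ (M + 1)); apply: filterS FV => x Vx.
  have M1 : M < M + 1 by rewrite ltrDl.
  exact: le_trans (mx_coord_le x i j) (VM _ M1 x Vx).
pose l := \matrix_(i, j) xget 0 [set l : R | (fun x : 'M[R]_(m, d) => x i j) @ F --> l].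
have lE i j : (fun x : 'M[R]_(m, d) => x i j) @ F --> l i j.
  rewrite mxE; exact: (@xgetPex _ 0 _ (coord i j)).
have Fl : F --> l.
  apply/cvgrPdist_le => e e0.
  have : F [set x : 'M[R]_(m, d) | forall p : 'I_m * 'I_d, `|l p.1 p.2 - x p.1 p.2| <= e].
    apply: filter_forall => p.
    by move/cvgrPdist_le : (lE p.1 p.2) => /(_ e e0).
  apply: filterS => x xl; apply: mx_norm_le; first exact: ltW.
  by move=> i j; have := xl (i, j); rewrite !mxE.
exists l; split => //.
apply: Vcl => A /Fl FA.
by have [x ?] := filter_ex (filterI FV FA); exists x.
Qed.

(** Equicontinuity passes to the limit [l]; near each point of [V] three errors of [e / 3] add up,
    and compactness makes the choice of [k] uniform on [V]. *)
Lemma ascoli_ultra (E : normedModType R) (G : set_system nat) (U V : set E)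
    (phi : nat -> E -> R) (l : E -> R) :
  UltraFilter G -> open U -> compact V -> V `<=` U ->
  (forall z, U z -> phi^~ z @ G --> l z) ->
  (forall v, V v -> forall e, 0 < e -> \forall y \near v, forall k, `|phi k y - phi k v| <= e) ->
  forall e, 0 < e -> \forall k \near G, forall z, V z -> `|phi k z - l z| <= e.
Proof.
move=> UG oU cV VU phil phie e e0.
have e3 : 0 < e / 3 by rewrite divr_gt0.
have /compact_near_coveringP := cV.
move=> /(_ nat G (fun k z => `|phi k z - l z| <= e) _).
suff H : forall x, V x -> \forall x' \near x & i \near G, `|phi i x' - l x'| <= e.
  by move=> /(_ H); apply: filterS => k kV z Vz; exact: kV.
move=> v Vv.
have Uv : \forall y \near v, U y by apply: open_nbhs_nbhs; split=> //; exact: VU.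
have vG : \forall k \near G, `|phi k v - l v| <= e / 3.
  move/cvgrPdist_le : (phil v (VU v Vv)) => /(_ _ e3).
  by apply: filterS => k; rewrite distrC.
have phiv := phie v Vv _ e3.
near=> y k.
have Uy : U y by near: y.
have A1 : forall k, `|phi k y - phi k v| <= e / 3 by near: y.
have A2 : `|phi k v - l v| <= e / 3 by near: k.
have A3 : `|l y - l v| <= e / 3.
  have : (fun k => `|phi k y - phi k v|) @ G --> `|l y - l v|.
    by apply: cvg_norm; apply: cvgB; [exact: phil|apply: phil; exact: VU].
  by move=> /cvgr_to_le; apply; near=> i; exact: A1.
move: (A1 k) A2 A3; rewrite !ler_norml; lra.
Unshelve. all: by end_near. Qed.

(** Every member of [G] meets every neighbourhood of infinity, so each [P j] holds at an index
    beyond the one chosen before. *)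
Lemma ultra_subsequence (G : set_system nat) (P : nat -> nat -> Prop) :
  UltraFilter G -> \oo `<=` G -> (forall j, G (P j)) ->
  exists2 phi : nat -> nat, {homo phi : i j / (i < j)%N} & forall j, P j (phi j).
Proof.
move=> UG ooG GP.
have pickP (Nj : nat * nat) : exists k, (Nj.1 <= k)%N /\ P Nj.2 k.
  have [k [? ?]] := filter_ex (filterI (ooG _ (nbhs_infty_ge Nj.1)) (GP Nj.2)).
  by exists k.
have [pick pickE] := choice pickP.
pose phi := fix phi j := if j is i.+1 then pick ((phi i).+1, i.+1) else pick (0, 0)%N.
exists phi.
  by apply: homo_ltn => // [? ? ?|i]; [exact: ltn_trans|exact: (pickE ((phi i).+1, i.+1)).1].
by case=> [|i]; [exact: (pickE (0, 0)%N).2|exact: (pickE ((phi i).+1, i.+1)).2].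
Qed.

End UltraLimits.

(** * Interpolation estimates uniform over all functions with given bounds *)

Section LandauUniform.
Variables (R : realType) (m d : nat).
Local Notation E := 'M[R]_(m, d).
Local Notation I := ('I_m * 'I_d)%type.
Local Notation b p := (delta_mx p.1 p.2 : E).

Definition landau_bounds (g : E -> R) (z : E) (delta L M : R) :=
  forall (y : E) (p : I), `|y - z| < delta ->
  [/\ derivable g y (b p), derivable ('D_(b p) g) y (b p),
      `|'D_(b p) g y| <= L & `|'D_(b p) ('D_(b p) g) y| <= M].

Lemma matrix_sum_basis (h : E) : h = \sum_p h p.1 p.2 *: b p.
Proof. by rewrite [LHS]matrix_sum_delta pair_bigA. Qed.

Lemma near0_small (a e : R) : 0 <= a -> 0 < e -> \forall t \near 0^'+, a * t <= e.
Proof.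
move=> a0 e0; near=> t.
have t0 : 0 < t by [].
have : t <= e / (a + 1) by near: t; apply: nbhs_right_le; rewrite divr_gt0 ?ltr_wpDl.
rewrite ler_pdivlMr ?ltr_wpDl // => H; apply: le_trans H; nra.
Unshelve. all: by end_near. Qed.

(** The point is the order of quantifiers: [eta] depends on the bounds and not on [g], which is
    equicontinuity of the functions and of their first derivatives. *)
Lemma landau_uniform (z : E) (delta L M e : R) : 0 < delta -> 0 <= L -> 0 <= M -> 0 < e ->
  exists2 eta : R, 0 < eta & forall g, landau_bounds g z delta L M ->
  forall h : E, `|h| < eta ->
  [/\ `|g (z + h) - g z| <= e,
      forall p, `|'D_(b p) g (z + h) - 'D_(b p) g z| <= e &
      `|g (z + h) - g z - \sum_p h p.1 p.2 * 'D_(b p) g z| <= e * `|h|].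
Proof.
move=> delta0 L0 M0 e0.
pose s := index_enum [the finType of I]; pose N : R := (size s)%:R.
have N0 : 0 <= N by [].
pose e' := e / (N + 1).
have e'0 : 0 < e' by rewrite divr_gt0 // ltr_wpDl.
have e'e : e' <= e by rewrite ler_pdivrMr ?ltr_wpDl //; nra.
have Ne' : N * e' <= e by rewrite mulrA ler_pdivrMr ?ltr_wpDl //; nra.
(* First the step [t] of the difference quotients is made small against [M], then [eta] small
   against [t]. *)
have [t [t0 tdelta Mt]] : exists t : R, [/\ 0 < t, t < delta / 2 & 2 * M * t <= e' / 3].
  have H : \forall t \near (0 : R)^'+, [/\ 0 < t, t < delta / 2 & 2 * M * t <= e' / 3].
    near=> t; split => //.
      by near: t; apply: nbhs_right_lt; rewrite divr_gt0.
    by near: t; apply: near0_small; rewrite ?mulr_ge0 // divr_gt0.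
  by have [t ?] := filter_ex H; exists t.
have [eta [eta0 H1 H2 H3 H4]] : exists eta : R, [/\ 0 < eta, N * eta <= delta / 2,
    2 * (N * L) / t * eta <= e' / 3, M * eta <= e' / 3 & N * L * eta <= e].
  have H : \forall eta \near (0 : R)^'+, [/\ 0 < eta, N * eta <= delta / 2,
    2 * (N * L) / t * eta <= e' / 3, M * eta <= e' / 3 & N * L * eta <= e].
    near=> x; split => //; near: x; apply: near0_small => //;
      by rewrite ?(divr_gt0 e'0) ?(divr_gt0 delta0) ?divr_ge0 ?mulr_ge0 // ltW.
  by have [x ?] := filter_ex H; exists x.
exists eta => // g gb h heta.
have g1 y p : `|y - z| < delta -> derivable g y (b p) by move=> /(gb y p)[].
have g2 y p : `|y - z| < delta -> derivable ('D_(b p) g) y (b p).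
  by move=> /(gb y p)[].
have g3 y p : `|y - z| < delta -> `|'D_(b p) g y| <= L by move=> /(gb y p)[].
have g4 y p : `|y - z| < delta -> `|'D_(b p) ('D_(b p) g) y| <= M.
  by move=> /(gb y p)[].
have h0 := normr_ge0 h.
have Nh : N * `|h| <= delta / 2.
  by apply: le_trans H1; rewrite ler_wpM2l // ltW.
have K2 : 2 * (N * (L * `|h|)) / t <= e' / 3.
  apply: le_trans H2; rewrite (_ : _ / t = 2 * (N * L) / t * `|h|); last by ring.
  by rewrite ler_wpM2l ?(ltW heta) // divr_ge0 ?mulr_ge0 // ltW.
have K3 : M * `|h| <= e' / 3 by apply: le_trans H3; rewrite ler_wpM2l // ltW.
have tN : t + N * `|h| < delta by lra.
rewrite {1 3}(matrix_sum_basis h); split.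
- apply: le_trans (psum_lipschitz L0 g1 g3 (delta := delta) _) _.
    by rewrite subrr normr0 add0r -/s -/N; lra.
  by apply: le_trans H4; rewrite -/s -/N -mulrA ler_wpM2l // ler_wpM2l // ltW.
- move=> p; rewrite {1}(matrix_sum_basis h).
  apply: le_trans (psum_derive L0 M0 g1 g2 g3 g4 p t0 tN) _; rewrite -/N; lra.
- apply: le_trans (psum_taylor L0 M0 g1 g2 g3 g4 t0 (leqnn _) tN) _.
  rewrite -/N mulrA ler_wpM2r //; apply: le_trans Ne'; rewrite ler_wpM2l //; lra.
Unshelve. all: by end_near. Qed.

End LandauUniform.

(** * Sequences with bounded pure second derivatives *)

Section LandauNormal.
Variables (R : realType) (m d q : nat).
Local Notation E := 'M[R]_(m, d).
Local Notation I := ('I_m * 'I_d)%type.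
Local Notation b p := (delta_mx p.1 p.2 : E).

Lemma differentiable_of_taylor (g : E -> 'rV[R]_q) (D : 'I_q -> I -> R) z :
  (forall e, 0 < e -> \forall h \near (0 : E), forall a,
    `|g (z + h) ord0 a - g z ord0 a - \sum_p h p.1 p.2 * D a p| <= e * `|h|) ->
  differentiable g z /\ forall h a, ('d g z h) ord0 a = \sum_p h p.1 p.2 * D a p.
Proof.
move=> taylor.
pose df (h : E) : 'rV[R]_q := \row_a \sum_p h p.1 p.2 * D a p.
have df_lin : linear df.
  move=> k x y; apply/rowP => a; rewrite !mxE mulr_sumr -big_split /=.
  by apply: eq_bigr => p _; rewrite !mxE; ring.
pose dfL : {linear E -> 'rV[R]_q} :=
  HB.pack_for {linear E -> 'rV[R]_q} df (GRing.isLinear.Build _ _ _ _ df df_lin).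
have df_cont : continuous dfL.
  have near1 : \forall h \near (0 : E), `|h| <= 1 by exact: nbhs0_le.
  pose S : R := \sum_(a : 'I_q) \sum_(p : I) `|D a p|.
  have S0 : 0 <= S by apply: sumr_ge0 => a _; apply: sumr_ge0.
  apply/linear_bounded_continuous; exists S; split; first exact: num_real.
  move=> C /ltW C0; apply: filterS near1 => h h1.
  apply: mx_norm_le => [|i a]; first exact: le_trans S0 C0.
  apply: le_trans C0; rewrite ord1 mxE /S (bigD1 a) //=; apply: ler_wpDr.
    by apply: sumr_ge0 => k _; apply: sumr_ge0.
  apply: le_trans (ler_norm_sum _ _ _) _; apply: ler_sum => p _.
  rewrite normrM ler_piMl //; exact: le_trans (mx_coord_le _ _ _) h1.
have eqn : g \o shift z = cst (g z) + (dfL : E -> 'rV[R]_q) +o_ (0 : E) id.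
  apply/eqaddoP => e e0; near=> h.
  have he : forall a, `|g (z + h) ord0 a - g z ord0 a - \sum_p h p.1 p.2 * D a p| <= e * `|h|.
    by near: h; exact: taylor.
  apply: mx_norm_le; first by rewrite mulr_ge0 // ltW.
  move=> i a; rewrite (ord1 i).
  have := he a; congr (`|_| <= _).
  by rewrite [z + h]addrC !mxE opprD addrA.
have dE := diff_unique df_cont eqn.
split; last by move=> h a; rewrite dE mxE.
by apply/diff_locallyP; rewrite dE; split.
Unshelve. all: by end_near. Qed.

(** The expansions of [landau_uniform] pass to the limit, so the limit function is differentiable
    and its partial derivatives are the limits of those of the sequence. [ascoli_ultra] makes the
    convergence uniform on [V]. *)
Lemma landau_normal (fs : nat -> E -> 'rV[R]_q) (U V : set E) (c : R) :
  open U -> compact V -> V `<=` U ->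
  (forall k z a, U z -> `|fs k z ord0 a| <= c) ->
  (forall z, U z -> exists delta L M : R, [/\ 0 < delta, 0 <= L, 0 <= M &
     forall k a, landau_bounds (fun y => fs k y ord0 a) z delta L M]) ->
  exists2 phi : nat -> nat, {homo phi : i j / (i < j)%N} &
  exists2 g : E -> 'rV[R]_q, (forall z, V z -> differentiable g z) &
  forall j z, V z -> forall a,
    `|fs (phi j) z ord0 a - g z ord0 a| <= j.+1%:R^-1 /\
    forall h : E, `|\sum_p h p.1 p.2 * 'D_(b p) (fun y => fs (phi j) y ord0 a) z -
                ('d g z h) ord0 a| <= j.+1%:R^-1 * \sum_p `|h p.1 p.2|.
Proof.
move=> oU cV VU fc fL.
(* A single ultrafilter finer than the filter at infinity gives the limits of all values and all
   partial derivatives at once, in place of successive extractions. *)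
have [G [UG ooG]] := ultraFilterLemma eventually_filter.
pose f k a y := fs k y ord0 a.
pose df p k a y := 'D_(b p) (f k a) y.
(* The limit exists at every point of [U], so the default 0 can only occur outside [U]. *)
pose l a y := xget 0 [set l : R | (fun k => f k a y) @ G --> l].
pose dl p a y := xget 0 [set l : R | (fun k => df p k a y) @ G --> l].
have fl a y : U y -> (fun k => f k a y) @ G --> l a y.
  move=> Uy; have fG : G [set k | `|f k a y| <= c] by apply: filterE => k; exact: fc.
  exact: (@xgetPex _ 0 [set l : R | (fun k => f k a y) @ G --> l] (ultra_cvg UG fG)).
have dfl p a y : U y -> (fun k => df p k a y) @ G --> dl p a y.
  move=> Uy; have [delta [L [M [delta0 _ _ fb]]]] := fL y Uy.
  have fG : G [set k | `|df p k a y| <= L].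
    apply: filterE => k; have [|_ _ + _] := fb k a y p; last exact.
    by rewrite subrr normr0.
  exact: (@xgetPex _ 0 [set l : R | (fun k => df p k a y) @ G --> l] (ultra_cvg UG fG)).
have unif z : U z -> forall e, 0 < e -> exists2 eta : R, 0 < eta &
    forall k a (h : E), `|h| < eta ->
    [/\ `|f k a (z + h) - f k a z| <= e,
      forall p, `|df p k a (z + h) - df p k a z| <= e &
      `|f k a (z + h) - f k a z - \sum_p h p.1 p.2 * df p k a z| <= e * `|h|].
  move=> Uz e e0; have [delta [L [M [delta0 L0 M0 fb]]]] := fL z Uz.
  have [eta eta0 H] := landau_uniform z delta0 L0 M0 e0.
  by exists eta => // k a h heta; exact: H (fb k a) h heta.
have near_shift (v : E) (eta : R) : 0 < eta -> \forall y \near v, `|y - v| < eta.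
  move=> eta0; apply/nbhs_ballP; exists eta => // y.
  by rewrite -ball_normE /= distrC.
pose g y := \row_a l a y.
have gD z : U z -> differentiable g z /\
    forall h a, ('d g z h) ord0 a = \sum_p h p.1 p.2 * dl p a z.
  move=> Uz; apply: differentiable_of_taylor => e e0.
  have [eta eta0 H] := unif z Uz e e0.
  have UzN : \forall h \near (0 : E), U (z + h).
    have : \forall y \near z, U y by exact: open_nbhs_nbhs.
    move=> /nbhs_ballP[r /= r0 zr]; apply/nbhs_ballP; exists r => // h.
    rewrite -ball_normE /= sub0r normrN => hr; apply: zr.
    by rewrite -ball_normE /= opprD addNKr normrN.
  have etaN : \forall h \near (0 : E), `|h| < eta by exact: nbhs0_lt.
  near=> h => a.
  have Uzh : U (z + h) by near: h.
  have heta : `|h| < eta by near: h.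
  rewrite !mxE.
  have : (fun k => `|f k a (z + h) - f k a z - \sum_p h p.1 p.2 * df p k a z|) @ G -->
      `|l a (z + h) - l a z - \sum_p h p.1 p.2 * dl p a z|.
    apply: cvg_norm; apply: cvgB; first by apply: cvgB; exact: fl.
    apply: cvg_big => [|p _]; first exact: add_continuous.
    apply: cvgM; first exact: cvg_cst.
    exact: dfl.
  by move=> /cvgr_to_le; apply; apply: filterE => k; have [] := H k a h heta.
have small e : 0 < e -> \forall k \near G, forall a z, V z ->
    `|f k a z - l a z| <= e /\ forall p, `|df p k a z - dl p a z| <= e.
  move=> e0.
  have A1 a : \forall k \near G, forall z, V z -> `|f k a z - l a z| <= e.
    apply: (ascoli_ultra (phi := fun k => f k a) UG oU cV VU) => //; first exact: fl.
    move=> v Vv e1 e10; have [eta eta0 H] := unif v (VU v Vv) e1 e10.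
    apply: filterS (near_shift v eta eta0) => y yv k.
    by have [+ _ _] := H k a (y - v) yv; rewrite [v + _]addrC subrK.
  have A2 a p : \forall k \near G, forall z, V z -> `|df p k a z - dl p a z| <= e.
    apply: (ascoli_ultra (phi := fun k => df p k a) UG oU cV VU) => //; first exact: dfl.
    move=> v Vv e1 e10; have [eta eta0 H] := unif v (VU v Vv) e1 e10.
    apply: filterS (near_shift v eta eta0) => y yv k.
    by have [_ + _] := H k a (y - v) yv => /(_ p); rewrite [v + _]addrC subrK.
  have A3 : G [set k | forall a, (forall z, V z -> `|f k a z - l a z| <= e) /\
      forall p z, V z -> `|df p k a z - dl p a z| <= e].
    apply: filter_forall => a; apply: filterI; first exact: A1.
    by apply: filter_forall => p; exact: A2.
  apply: filterS A3 => k kP a z Vz; have [k1 k2] := kP a.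
  by split=> [|p]; [exact: k1|exact: k2].
have smallj j := small j.+1%:R^-1 (ltac:(by rewrite invr_gt0)).
have [phi phi_homo phiP] := ultra_subsequence UG ooG smallj.
exists phi => //; exists g; first by move=> z /VU /gD[].
move=> j z Vz a; have [k1 k2] := phiP j a z Vz; split; first by rewrite mxE.
move=> h; have [_ ->] := gD z (VU z Vz).
rewrite -sumrB mulr_sumr; apply: le_trans (ler_norm_sum _ _ _) _.
by apply: ler_sum => p _; rewrite -mulrBr normrM mulrC ler_wpM2r //; exact: k2.
Unshelve. all: by end_near. Qed.

End LandauNormal.

(** * Pseudoconformal families *)

Section Pseudoconformality.
Variables (R : realType) (r n : nat).
Hypothesis r_le3 : (r <= 3)%N.
Local Notation d := (cd_dim r).
Hypothesis d_ge3 : (2 < d)%N.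
Local Notation E := 'M[R]_(n, d).

Lemma embE j (h : 'rV[R]_d) i k :
  (emb (n := n) j h) i k = if i == j then h ord0 k else 0.
Proof. by rewrite mxE big_ord1 !mxE eqxx andbT; case: eqP; rewrite ?mul1r ?mul0r. Qed.

Lemma emb_delta (j : 'I_n) i : emb j (delta_mx 0 i : 'rV[R]_d) = delta_mx j i.
Proof. by rewrite /emb mul_delta_mx. Qed.

Lemma derive_slice (f : E -> 'rV[R]_d) xi j h a :
  'D_h (fun w => slice f xi j w ord0 a) (row j xi) =
  'D_(emb j h) (fun z => f z ord0 a) xi.
Proof.
have sliceE s : slice f xi j (s *: h + row j xi) = f (s *: emb j h + xi).
  congr f; apply/matrixP => i k; rewrite [RHS]mxE [X in _ = X + _]mxE embE !mxE.
  by case: eqP => [->|_]; rewrite ?mulr0 ?add0r.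
have slice0 : slice f xi j (row j xi) = f xi.
  congr f; apply/matrixP => i k; rewrite !mxE.
  by case: eqP => [->|].
have E : (fun s : R => s^-1 *: (slice f xi j (s *: h + row j xi) ord0 a -
      slice f xi j (row j xi) ord0 a)) =
    (fun s => s^-1 *: (f (s *: emb j h + xi) ord0 a - f xi ord0 a)).
  by apply/funext => s; rewrite sliceE slice0.
exact: (congr1 (fun u => lim (u @ 0^')) E).
Qed.

(** For orthogonal increments the right side of the angle condition vanishes, and the positive
    factor |h1| |h2| on the left cancels. A zero derivative satisfies the conclusion trivially. *)
Lemma slice_derivative (f : E -> 'rV[R]_d) xi j :
  pseudoconformal_by j f xi \/ zero_derivative_by j f xi ->
  forall h1 h2 : 'rV[R]_d, h1 != 0 -> h2 != 0 -> dot h1 h2 = 0 ->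
  dot (\row_a 'D_(emb j h1) (fun z => f z ord0 a) xi)
      (\row_a 'D_(emb j h2) (fun z => f z ord0 a) xi) = 0.
Proof.
move=> conf h1 h2 h10 h20 h12.
have enorm_gt0 (h : 'rV[R]_d) : h != 0 -> 0 < enorm h.
  by move=> h0; rewrite lt0r enorm_ge0 andbT; apply: contraNneq h0 => /enorm_eq0 ->.
have TE A B : @superderivatives R r 1 (slice f xi j) (row j xi) ord0 A B ->
    forall h, \row_a 'D_(emb j h) (fun z => f z ord0 a) xi = A h + B h.
  move=> AB h; apply/rowP => a; rewrite mxE -derive_slice.
  exact: superderivatives_derive.
case: conf => [[A [AB conf _ _]]|AB]; last first.
  by rewrite !(TE _ _ AB) addr0 /dot big1 // => k _; rewrite mxE mul0r.
rewrite !(TE _ _ AB) !addr0.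
have := conf h1 h2; rewrite !cd_re_mul_conj h12 mulr0 => /eqP.
have h120 : enorm h1 * enorm h2 != 0 by rewrite gt_eqF // mulr_gt0 ?enorm_gt0.
by rewrite mulf_eq0 (negPf h120) orbF => /eqP.
Qed.

(* Angle preservation is only used for orthogonal vectors: e_i, e_k give
   orthogonal columns, and e_i + e_k, e_i - e_k columns of equal norm. *)
Lemma pseudoconformal_dot (f : E -> 'rV[R]_d) xi j :
  (forall a, analytic_at (fun z => f z ord0 a) xi) ->
  pseudoconformal_by j f xi \/ zero_derivative_by j f xi ->
  forall i k, dot (V1 f j i xi) (V1 f j k xi) = mu d_ge3 f j xi * (i == k)%:R.
Proof.
move=> fan /slice_derivative conf.
pose e i : 'rV[R]_d := delta_mx 0 i.
have e_dot i k : dot (e i) (e k) = (i == k)%:R.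
  rewrite /dot (bigD1 i) //= big1 => [|l /negPf li]; last by rewrite !mxE li mul0r.
  by rewrite !mxE !eqxx mul1r addr0.
have nz i k (s : R) : i != k -> e i + s *: e k != 0.
  move=> /negPf ik; apply/negP => /eqP/rowP/(_ i).
  by rewrite !mxE /= eqxx ik mulr0 addr0 => /eqP; rewrite oner_eq0.
have rowE s i k : \row_a 'D_(emb j (s *: e k + e i)) (fun z => f z ord0 a) xi =
    s *: V1 f j k xi + V1 f j i xi.
  by apply/rowP => a; rewrite embP [LHS]mxE (analytic_at_derivP r_le3 _ _ _ (fan a)) !mxE.
have orth i k : i != k -> dot (V1 f j i xi) (V1 f j k xi) = 0.
  move=> ik; have := conf (e i) (e k); apply; last by rewrite e_dot (negPf ik).
    by have := nz i k 0 ik; rewrite scale0r addr0.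
  by rewrite eq_sym in ik; have := nz k i 0 ik; rewrite scale0r addr0.
have same i k : dot (V1 f j i xi) (V1 f j i xi) = dot (V1 f j k xi) (V1 f j k xi).
  have [->//|ik] := eqVneq i k; have ki : k != i by rewrite eq_sym.
  have sum_neq0 (t : R) : t *: e k + e i != 0 by rewrite addrC nz.
  have sum_dot : dot (1 *: e k + e i) (- 1 *: e k + e i) = 0.
    rewrite scale1r scaleN1r !(dotDl, dotDr, dotNr) !e_dot !eqxx (negPf ik) (negPf ki).
    by rewrite /= addr0 oppr0 add0r addNr.
  have := conf _ _ (sum_neq0 1) (sum_neq0 (- 1)) sum_dot.
  rewrite (rowE 1 i k) (rowE (- 1) i k).
  move: (orth i k ik) (orth k i ki); move: (V1 f j i xi) (V1 f j k xi) => v w vw wv.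
  rewrite scale1r scaleN1r !(dotDl, dotDr, dotNr) vw wv.
  by rewrite addr0 oppr0 add0r addrC => /eqP; rewrite subr_eq0 => /eqP.
move=> i k; have [->|ik] := eqVneq i k; last by rewrite mulr0 orth.
by rewrite mulr1; exact: same.
Qed.

End Pseudoconformality.

(** * Interpolation bounds for the members of the family *)

Section FamilyBounds.
Variables (R : realType) (r n : nat).
Hypothesis r_le3 : (r <= 3)%N.
Local Notation d := (cd_dim r).
Hypothesis d_ge3 : (2 < d)%N.
Local Notation E := 'M[R]_(n, d).
Variables (U : set E) (f : E -> 'rV[R]_d).
Hypothesis U_open : open U.
Hypothesis f_holo : holomorphic U f.
Hypothesis f_conf : forall xi, U xi -> forall j,
  pseudoconformal_by j f xi \/ zero_derivative_by j f xi.

Lemma holomorphic_analytic_at x a : U x -> analytic_at (fun z => f z ord0 a) x.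
Proof. by move=> /f_holo[_ [P [Pf _]]]; exact: represents_analytic_at Pf. Qed.

(** The radius [2 * delta] leaves, around each [y] within [delta] of [z], a ball of radius [delta]
    in the variable _jz inside [U]; the conformal bounds are applied there. *)
Lemma conformal_landau_bounds z delta c a : 0 < delta ->
  (forall y, `|y - z| < 2 * delta -> U y) -> (forall y, U y -> enorm (f y) <= c) ->
  landau_bounds (fun y => f y ord0 a) z delta (64 * c / delta) (128 * c / delta ^+ 2).
Proof.
move=> delta0 zU fc y [j i] yz /=.
have Uy : U y by apply: zU; lra.
have yU : box U j y delta.
  move=> e ee; apply: zU; rewrite addrAC; apply: le_lt_trans (ler_normD _ _) _.
  have : `|emb j e : E| <= enorm e.
    apply: mx_norm_le => [|k l]; first exact: enorm_ge0.
    by rewrite embE; case: eqP => _; rewrite ?normr0 ?enorm_ge0 ?enorm_coord_le.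
  lra.
have fan x : U x -> forall a, analytic_at (fun z => f z ord0 a) x.
  by move=> Ux b; exact: holomorphic_analytic_at.
have fdot x : U x -> forall i k,
    dot (V1 f j i x) (V1 f j k x) = mu d_ge3 f j x * (i == k)%:R.
  by move=> Ux; apply: pseudoconformal_dot => //; [move=> b; exact: (fan x Ux b)|exact: f_conf].
rewrite -(emb_delta R j i); split.
- exact: (analytic_at_derivable r_le3 (fan y Uy a)).
- apply: analytic_at_derivable => //; apply: analytic_at_deriv => //. exact: (fan y Uy a).
- rewrite ler_pdivlMr // mulrC.
  exact: (conformal_derivative_bound r_le3 U_open fan fdot i a delta0 yU fc).
- rewrite ler_pdivlMr ?exprn_gt0 // mulrC.
  exact: (conformal_second_derivative_bound r_le3 U_open fan fdot i a delta0 yU fc).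
Qed.

Lemma diff_coord z h a : U z ->
  ('d f z h) ord0 a = \sum_p h p.1 p.2 * 'D_(delta_mx p.1 p.2) (fun y => f y ord0 a) z.
Proof.
move=> Uz; have [fd _] := f_holo Uz.
have fan := holomorphic_analytic_at a Uz.
rewrite -deriveE // derive_mx ?mxE; last exact: diff_derivable.
rewrite {1}(matrix_sum_basis h).
elim: (index_enum _) => [|p s IHs]; first by rewrite !big_nil derive0.
by rewrite !big_cons (analytic_at_derivP r_le3 _ _ _ fan) IHs.
Qed.

End FamilyBounds.

(** * The distance [rho] and normality *)

Lemma rho_le (R : realType) (r n : nat) (V : set 'M[R]_(n, cd_dim r))
    (f g : 'M[R]_(n, cd_dim r) -> 'rV[R]_(cd_dim r)) (e : R) : 0 <= e ->
  (forall z, V z -> forall a, `|f z ord0 a - g z ord0 a| <= e /\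
     forall h : 'M[R]_(n, cd_dim r),
     `|('d f z h) ord0 a - ('d g z h) ord0 a| <= e * \sum_(p : 'I_n * 'I_(cd_dim r)) `|h p.1 p.2|) ->
  (rho V f g <= ((1 * cd_dim r)%:R * (1 + #|{: 'I_n * 'I_(cd_dim r)}|%:R) * e)%:E)%E.
Proof.
move=> e0 fg; apply: ge_ereal_sup => _ [z Vz <-].
rewrite (_ : _ * e = (1 * cd_dim r)%:R * e +
  (1 * cd_dim r)%:R * (e * #|{: 'I_n * 'I_(cd_dim r)}|%:R)); last by ring.
rewrite EFinD; apply: leeD.
  rewrite lee_fin; apply: enorm_le_coord => // i a.
  by rewrite (ord1 i) !mxE; exact: (fg z Vz a).1.
apply: ge_ereal_sup => _ [h h1 <-]; rewrite lee_fin.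
apply: enorm_le_coord => [|i a]; first by rewrite mulr_ge0.
rewrite (ord1 i) !mxE; apply: le_trans ((fg z Vz a).2 h) _.
(* The entries of an increment of norm 1 are at most 1, so their sum is at most their number. *)
rewrite ler_wpM2l //; apply: (@le_trans _ _ (\sum_(p : 'I_n * 'I_(cd_dim r)) 1)).
  by apply: ler_sum => p _; rewrite -h1; exact: enorm_coord_le.
by rewrite sumr_const.
Qed.

(** The hypotheses supply a point of [V] and an increment of norm 1; over an empty set either
    supremum would be -oo. *)
Lemma rho_ge0 (R : realType) (r n : nat) (V : set 'M[R]_(n, cd_dim r))
    (f g : 'M[R]_(n, cd_dim r) -> 'rV[R]_(cd_dim r)) :
  (0 < n)%N -> V !=set0 -> (0 <= rho V f g)%E.
Proof.
move=> n0 [z Vz].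
have d0 : (0 < cd_dim r)%N by rewrite cd_dimE expn_gt0.
apply: le_ereal_sup_tmp; exists (adde (enorm (f z - g z))%:E (deriv_dist f g z)).
  by exists z.
apply: adde_ge0; first by rewrite lee_fin enorm_ge0.
pose h : 'M[R]_(n, cd_dim r) := delta_mx (Ordinal n0) (Ordinal d0).
apply: le_ereal_sup_tmp; exists (enorm ('d f z h - 'd g z h))%:E.
  by exists h => //=; exact: enorm_delta.
by rewrite lee_fin enorm_ge0.
Qed.

Unset Implicit Arguments.

Theorem theorem13 (R : realType) (r n : nat)
    (hr : r = 2%N \/ r = 3%N) (hn : (0 < n)%N)
    (U : set 'M[R]_(n, cd_dim r)) (U_domain : domain U)
    (U_D : domain_condition U)
    (F : set ('M[R]_(n, cd_dim r) -> 'rV[R]_(cd_dim r)))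
    (F_holo : forall f, F f -> holomorphic U f)
    (F_conf : forall f, F f -> forall xi, U^° xi -> forall j : 'I_n,
       pseudoconformal_by j f xi \/ zero_derivative_by j f xi)
    (F_bounded :
       (ereal_sup [set (enorm (f z))%:E | z in U^° & f in F] < +oo)%E) :
  normal_family U F.
Proof.
have r_le3 : (r <= 3)%N by case: hr => ->.
have d_ge3 : (2 < cd_dim r)%N by case: hr => ->.
have [_ oU _] := U_domain.
rewrite (interior_id U).1 // in F_conf F_bounded.
split=> // f_ f_F V V0 Vcl Vbd _ VU.
have [c fc] : exists c, forall k y, U y -> enorm (f_ k y) <= c.
  move: F_bounded; set A := [set _ | _ in _ & _ in _] => F_bounded.
  have ub k y : U y -> ((enorm (f_ k y))%:E <= ereal_sup A)%E.
    by move=> Uy; apply: ereal_sup_ubound; exists y => //; exists (f_ k).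
  case: (ereal_sup A) F_bounded ub => [s|//|] _ ub.
    by exists s => k y /(ub k); rewrite lee_fin.
  (* The supremum -oo would contradict [ub] at any point of [U]. *)
  by exists 0 => k y /(ub k).
have cV := bounded_closed_compact_mx Vbd Vcl.
have [||phi phi_homo [g g_diff gP]] := @landau_normal R n (cd_dim r) (cd_dim r) f_ U V c oU cV VU.
- by move=> k z a Uz; exact: le_trans (enorm_coord_le _ _ _) (fc k z Uz).
- move=> z Uz.
  have : \forall y \near z, U y by exact: open_nbhs_nbhs.
  move=> /nbhs_ballP[e /= e0 eU]; exists (e / 2), (64 * c / (e / 2)), (128 * c / (e / 2) ^+ 2).
  have c0 : 0 <= c := le_trans (enorm_ge0 _) (fc 0%N z Uz).
  have e2 : 0 < e / 2 by rewrite divr_gt0.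
  have L0 : 0 <= 64 * c / (e / 2) by apply: divr_ge0; [exact: mulr_ge0|exact: ltW].
  have M0 : 0 <= 128 * c / (e / 2) ^+ 2 by apply: divr_ge0; [exact: mulr_ge0|exact: sqr_ge0].
  split=> //.
  move=> k a; apply: (conformal_landau_bounds r_le3 d_ge3 oU (F_holo _ (f_F k)) (F_conf _ (f_F k))) => //.
    move=> y; rewrite mulrCA mulfV // mulr1 => yz; apply: eU.
    by rewrite -ball_normE /= distrC.
  exact: fc.
(* For a bounded family the limit can always be taken to be a differentiable function. *)
exists phi => //; left; exists g => //.
pose K : R := (1 * cd_dim r)%:R * (1 + #|{: 'I_n * 'I_(cd_dim r)}|%:R).
have rhoK : \forall k \near \oo,
    (0 <= rho V (f_ (phi k)) g <= (K * k.+1%:R^-1)%:E)%E.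
  apply: filterE => k; rewrite rho_ge0 //=; apply: rho_le => [|z Vz a].
    by rewrite invr_ge0.
  have [H1 H2] := gP k z Vz a; split=> // h.
  have dE := diff_coord r_le3 (F_holo _ (f_F (phi k))) h a (VU z Vz).
  exact: (eq_ind_r (fun x => `|x - ('d g z h) ord0 a| <= _) (H2 h) dE).
apply: (squeeze_cvge rhoK); first exact: cvg_cst.
apply: cvg_EFin; first exact: filterE.
rewrite -[X in _ --> X](mulr0 K).
by apply: cvgM; [exact: cvg_cst|exact: cvg_harmonic].
Qed.
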